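(* In the setting described in the context, let $R$ be the set of all real $h\neq 0$ such that $(f_j)$ is reducible to an $h\mathbb Z$-valued sequence, and let $\mathsf H=\{1/r: r\in R\}\cup\{0\}$. If $(f_j)$ is reducible and $\sigma_n(\kappa_0)\to\infty$, then $\mathsf H=h_0\mathbb Z$ for some $h_0>0$. As a consequence, $r_0=1/h_0$ is the largest positive number such that $(f_j)$ is reducible to an $r_0\mathbb Z$-valued sequence. Therefore $f_j$ can be written as $f_j=\kappa_0(f_j\circ T_0^j)+H_j+r_0Z_j$ for all $j\ge 0$, where $\sup_j\|H_j\|_\beta<\infty$, the sequence $(S_nH)_{n\ge1}$ is tight, and $(Z_j)$ is an irreducible sequence of $\mathbb Z$-valued functions.
   Context: Maps. Let $(X_j,\mathsf d_j)$ be metric spaces of diameter at most $1$ and $T_j:X_j\to X_{j+1}$ maps, where $j$ ranges over $\{0,1,2,\dots\}$ in case (A) below and over $\mathbb Z$ in case (B). Put $T_j^n=T_{j+n-1}\circ\cdots\circ T_{j+1}\circ T_j$; $B_j(x,r)$ is the open ball in $X_j$. (Pairing) There are $0<\xi\le1$, $\gamma>1$ such that for all $j$ and $x,x'\in X_{j+1}$ with $\mathsf d_{j+1}(x,x')\le\xi$ one can write $T_j^{-1}\{x\}=\{y_i(x):0\le i\le k_j(x)\}$, $T_j^{-1}\{x'\}=\{y_i(x'):0\le i\le k_j(x)\}$ with $\mathsf d_j(y_i(x),y_i(x'))\le\gamma^{-1}\mathsf d_{j+1}(x,x')$. Moreover $\sup_j\deg(T_j)<\infty$, where $\deg(T)$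 is the largest number of preimages of a point under $T$, and all $T_j$ are Lipschitz with constant at most some $K_0$ independent of $j$. (Covering) There is $n_0\in\mathbb N$ such that for every $j$ and $x\in X_j$, $T_j^{n_0}(B_j(x,\xi))=X_{j+n_0}$, and for every $j$ and $y\in X_j$ there is $W_{j,y}:X_{j+n_0}\to B_j(y,\xi)$ with $T_j^{n_0}\circ W_{j,y}=\mathrm{id}$; the maps $W_{j,y}$ are uniformly Lipschitz. Norms. Fix $\beta\in(0,1]$; $\|g\|_\beta=\sup|g|+G_{\beta}(g)$, where $G_\beta(g)$ is the Hölder constant of $g$ with exponent $\beta$. Measures. For functions $\phi_j:X_j\to\mathbb R$ with $\sup_j\|\phi_j\|_\beta<\infty$ put $L_jg(x)=\sum_{y:T_jy=x}e^{\phi_j(y)}g(y)$, $L_j^n=L_{j+n-1}\circ\cdots\circ L_j$. One of the following holds. (A) $j\ge0$; each $X_j$ carries a Borel probability measure $m_j$ with $(T_j)_*m_j\ll m_{j+1}$, and for some such $(\phi_j)$ one has $\int(u\circ T_j)\,g\,dm_j=\int u\,(L_jg)\,dm_{j+1}$ for all bounded measurable $u,g$. Put $\nu_j=m_j$, $\lambda_j=1$. (B) $j\in\mathbb Z$ and $(\phi_j)_{j\in\mathbb Z}$ is any sequence with $\sup_j\|\phi_j\|_\beta<\infty$. In both cases it is known that there are functions $h_j:X_j\to\mathbb R$ with $\inf_j\min h_j>0$, $\sup_j\|h_j\|_\beta<\infty$, probability measures $\nu_j$ on $X_j$ with $\nu_j(h_j)=1$, and numbers $\lambda_j$ bounded and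 bounded away from $0$ (with $\nu_j=m_j$, $\lambda_j=1$ in case (A)) such that $L_jh_j=\lambda_jh_{j+1}$, $L_j^*\nu_{j+1}=\lambda_j\nu_j$, and $\|(\lambda_j\cdots\lambda_{j+n-1})^{-1}L_j^ng-\nu_j(g)h_{j+n}\|_\beta\le C_0\delta^n\|g\|_\beta$ for some $C_0>0$, $\delta\in(0,1)$ and all $j,n,g$. Put $d\mu_j=h_jd\nu_j$; then $(T_j)_*\mu_j=\mu_{j+1}$. The initial measure $\kappa_0$ is a Borel probability measure on $X_0$ that is absolutely continuous with respect to $m_0$ in case (A), resp. $\mu_0$ in case (B), with Hölder continuous density. Observables. $f_j:X_j\to\mathbb R$, $j\ge0$, with $\sup_j\|f_j\|_\beta<\infty$. For a sequence $F=(F_j)$ put $S_nF=\sum_{j=0}^{n-1}F_j\circ T_0^j$, viewed as a random variable on $(X_0,\kappa_0)$; $\sigma_n(\kappa_0)=\sqrt{\mathrm{Var}_{\kappa_0}(S_nf)}$. Reducibility. A sequence $(f_j)$ of real valued functions is reducible to an $h\mathbb Z$-valued sequence ($h\ne0$) if there are $H_j:X_j\to\mathbb R$, $Z_j:X_j\to\mathbb Z$ with $\sup_j\|H_j\|_\beta<\infty$, $(S_nH)_{n\ge1}$ tight, and $f_j=\kappa_0(f_j\circ T_0^j)+H_j+hZ_j$ for all $j$. A real valued sequence is reducible if this holds for some $h\neq0$. A sequence of $\mathbb Z$-valued functions is called reducible (as a $\mathbb Z$-valued sequence) if this holds for some $h>1$. Irreducible means not reducible. *)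

(* Defs.v *)
From HB Require Import structures.
From mathcomp Require Import all_boot all_order all_algebra.
From mathcomp Require Import all_classical all_reals all_analysis.

Set Implicit Arguments.
Unset Strict Implicit.
Unset Printing Implicit Defensive.

Import Order.TTheory GRing.Theory Num.Theory.
Import numFieldNormedType.Exports.

Local Open Scope classical_set_scope.
Local Open Scope ring_scope.

(* The base point is only there because measurable types are pointed in the
   library; every space below carries a probability measure, hence is
   nonempty. *)
#[short(type="pmetricType")]
HB.structure Definition PointedMetric (K : numDomainType) :=
  { M of Metric K M & Pointed M }.

Definition borel (R : realType) (M : pmetricType R) :=
  g_sigma_algebraType (@open M).

(* Sequences of maps indexed by nat (reference measures are prescribed) or by
   the integers (arbitrary potentials). *)
Variant horizon := one_sided | two_sided.

Definition time (c : horizon) : Type :=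
  match c with one_sided => nat | two_sided => int end.

Definition time_succ (c : horizon) : time c -> time c :=
  match c with one_sided => S | two_sided => fun j : int => j + 1 end.

Definition time_zero (c : horizon) : time c :=
  match c with one_sided => 0%N | two_sided => 0 : int end.

(* The index j + n is [iter n s j], where s is the successor map; in this way
   [T_j^n] has type [X j -> X (iter n s j)] without casts. *)

Fixpoint map_iter (I : Type) (s : I -> I) (X : I -> Type)
    (T : forall j, X j -> X (s j)) (j : I) (n : nat) :
    X j -> X (iter n s j) :=
  match n with
  | 0 => fun x => x
  | m.+1 => fun x => T (iter m s j) (map_iter T m x)
  end.

Section norms.
Context (R : realType).

(* The diagonal contributes 0 to the second supremum, as 0 / 0 = 0. *)
Definition hoelder_norm (M : pmetricType R) (beta : R) (g : M -> R) : \bar R :=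
  (ereal_sup (range (fun x => (`|g x|)%:E)) +
   ereal_sup (range (fun p : M * M =>
     (`|g p.1 - g p.2| / (mdist p.1 p.2 `^ beta))%:E)))%E.

Definition bounded_hoelder (I : Type) (M : I -> pmetricType R) (beta : R)
    (g : forall j, M j -> R) :=
  exists C : R, forall j, (hoelder_norm beta (g j) <= C%:E)%E.

Definition lipschitz_le (M N : pmetricType R) (K : R) (T : M -> N) :=
  forall x x', mdist (T x) (T x') <= K * mdist x x'.

End norms.

Section maps.
Context (R : realType) (I : Type) (s : I -> I) (X : I -> pmetricType R).
Context (T : forall j, X j -> X (s j)).

(* The fibres are enumerated without repetition, so the pairing is a
   bijection between them. *)
Definition pairing (xi gamma : R) :=
  forall j (x x' : X (s j)), mdist x x' <= xi ->
  exists (k : nat) (y y' : 'I_k.+1 -> X j),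
    [/\ injective y, injective y',
        @T j @^-1` [set x] = range y,
        @T j @^-1` [set x'] = range y' &
        forall i, mdist (y i) (y' i) <= gamma^-1 * mdist x x'].

Definition bounded_degree :=
  exists D : nat, forall j (x : X (s j)), (@T j @^-1` [set x] #<= `I_D)%card.

Definition uniformly_lipschitz :=
  exists K0 : R, forall j, lipschitz_le K0 (@T j).

Definition covering (xi : R) :=
  exists n0 : nat,
    (forall j (x : X j), map_iter T n0 @` ball x xi = setT) /\
    exists K : R, forall j (y : X j),
      exists W : X (iter n0 s j) -> X j,
        [/\ forall z, ball y xi (W z),
            cancel W (map_iter T n0) &
            lipschitz_le K W].

End maps.

Section transfer_operators.
Context (R : realType) (I : Type) (s : I -> I) (X : I -> pmetricType R).
Context (T : forall j, X j -> X (s j)) (phi : forall j, X j -> R).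

(* The sum is a finite one as soon as [pairing T xi gamma] holds. *)
Definition transfer (j : I) (g : X j -> R) (x : X (s j)) : R :=
  \sum_(y \in @T j @^-1` [set x]) (expR (phi y) * g y).

Fixpoint transfer_iter (j : I) (n : nat) (g : X j -> R) :
    X (iter n s j) -> R :=
  match n return X (iter n s j) -> R with
  | 0 => g
  | m.+1 => transfer (@transfer_iter j m g)
  end.

Definition bounded_measurable (M : pmetricType R) (u : borel M -> R) :=
  measurable_fun setT u /\ exists C : R, forall x, `|u x| <= C.

Definition reference_measures (m : forall j, probability (borel (X j)) R) :=
  (forall j, pushforward (m j) (@T j : borel (X j) -> borel (X (s j)))
             `<< m (s j)) /\
  (forall j (u : X (s j) -> R) (g : X j -> R),
     bounded_measurable u -> bounded_measurable g ->
     (\int[m j]_x (u (T x) * g x)%:E =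
      \int[m (s j)]_x (u x * transfer g x)%:E)%E).

Definition rpf_triplets (beta : R) (h : forall j, X j -> R)
    (nu : forall j, probability (borel (X j)) R) (lam : I -> R) :=
  (exists2 a : R, 0 < a & forall j x, a <= h j x) /\
  bounded_hoelder beta h /\
  (forall j, \int[nu j]_x h j x = 1) /\
  (exists a b : R, 0 < a /\ forall j, a <= `|lam j| <= b) /\
  (forall j x, transfer (h j) x = lam j * h (s j) x) /\
  (forall j (g : X j -> R), (hoelder_norm beta g < +oo)%E ->
     \int[nu (s j)]_x transfer g x = lam j * \int[nu j]_x g x) /\
  exists C0 delta : R, 0 < C0 /\ 0 < delta < 1 /\
    forall j n (g : X j -> R), (hoelder_norm beta g < +oo)%E ->
      (hoelder_norm beta (fun x : X (iter n s j) =>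
         (\prod_(k < n) lam (iter k s j))^-1 * @transfer_iter j n g x
         - (\int[nu j]_y g y) * h (iter n s j) x)%R
       <= (C0 * delta ^+ n)%:E * hoelder_norm beta g)%E.

Definition weighted_measures (h : forall j, X j -> R)
    (nu mu : forall j, probability (borel (X j)) R) :=
  forall j (A : set (borel (X j))), measurable A ->
    mu j A = (\int[nu j]_(x in A) (h j x)%:E)%E.

End transfer_operators.

(* The exponent of the density is not required to be the fixed exponent. *)
Definition hoelder_density (R : realType) (M : pmetricType R)
    (m kappa : probability (borel M) R) :=
  exists (alpha : R) (psi : M -> R),
    [/\ 0 < alpha <= 1, (hoelder_norm alpha psi < +oo)%E,
        forall x, 0 <= psi x &
        forall A : set (borel M), measurable A ->
          kappa A = (\int[m]_(x in A) (psi x)%:E)%E].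

Definition tight (R : realType) (d : measure_display) (U : measurableType d)
    (P : probability U R) (Y : nat -> U -> R) :=
  forall eps : R, 0 < eps ->
  exists C : R, forall n, (P [set x | C < `|Y n x|]%R <= eps%:E)%E.

Section reducibility.
Context (R : realType) (I : Type) (s : I -> I) (X : I -> pmetricType R).
Context (T : forall j, X j -> X (s j)) (o : I).
Context (kappa0 : probability (borel (X o)) R) (beta : R).

Definition birkhoff_sum (F : forall n, X (iter n s o) -> R) (n : nat)
    (x : borel (X o)) : R :=
  \sum_(j < n) F j (map_iter T j x).

Definition std_dev (f : forall n, X (iter n s o) -> R) (n : nat) : R :=
  Num.sqrt (fine ('V_kappa0[birkhoff_sum f n])%E).

(* The shift by one in [tight] drops the trivial sum S_0. *)
Definition reduction (f : forall n, X (iter n s o) -> R) (a : R)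
    (H : forall n, X (iter n s o) -> R) (Z : forall n, X (iter n s o) -> int) :=
  [/\ bounded_hoelder beta H,
      tight kappa0 (fun n => birkhoff_sum H n.+1) &
      forall n x,
        f n x = \int[kappa0]_y f n (map_iter T n y) + H n x + a * (Z n x)%:~R].

Definition reducible_to (f : forall n, X (iter n s o) -> R) (a : R) :=
  a != 0 /\ exists H Z, reduction f a H Z.

Definition reducible (f : forall n, X (iter n s o) -> R) :=
  exists a, reducible_to f a.

Definition int_reducible (Z : forall n, X (iter n s o) -> int) :=
  exists2 a : R, 1 < a & reducible_to (fun n x => (Z n x)%:~R) a.

End reducibility.

(* Main.v *)
(** If (f_j - c_j) t = H_j + Z_j with Z_j integer valued, S_n H tight and H_j
    uniformly Hoelder, call t a frequency.  Frequencies form a subgroup of R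
    which contains 1/r exactly when (f_j) is reducible to an rZ-valued
    sequence, so everything reduces to showing that r cannot be large.

    First, tightness of S_n H forces bounded variance: after a martingale-
    coboundary decomposition H_j = E H_j + D_j + v_{j+1} o T_j - v_j the fourth
    moment of S_n D is at most a constant times a^2 + a, where a is its variance,
    and a Paley-Zygmund argument bounds a.  Hence the variances of the D_j are
    summable, and equicontinuity gives sup |D_j| -> 0.

    Now f_j = c_j + D_j + v_{j+1} o T_j - v_j mod r.  Comparing two backward
    orbits which shadow each other, and then covering the space by images of a
    small ball, one sees that v_j mod r has oscillation at most a constant
    depending on f and the maps but not on r.  If r is much larger than this
    constant, v_j lifts to a bounded real function u_j for which
    f_j - D_j - u_{j+1} o T_j + u_j is constant; then the variance of S_n f is
    bounded, contrary to the assumption. *)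

Require Import Defs.
From mathcomp Require Import all_boot all_order all_algebra.
From mathcomp Require Import all_classical all_reals all_analysis.
From mathcomp Require Import measurable_realfun ring lra.

Set Implicit Arguments.
Unset Strict Implicit.
Unset Printing Implicit Defensive.

Import Order.TTheory GRing.Theory Num.Theory.
Import numFieldNormedType.Exports.

Local Open Scope classical_set_scope.
Local Open Scope ring_scope.

(** * Hoelder functions *)

(** The threshold on r must be found before H is given, while the Hoelder constants of D and v
    depend on H, hence on r. Two choices, in this order, remove them: shadowing over q steps
    contracts the initial difference of v to at most 1, with q depending on these constants; then
    the starting time is moved so far that the D_j, now uniformly small, contribute at most 1 over q
    steps. What remains is a geometric series in the Hoelder constant of f.

    Tightness and variance refer to kappa_0, whose density may vanish somewhere, while the moments
    are computed under the equivariant measures. The upper bound of the density suffices to carry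
    variance bounds to kappa_0. For tightness only a lower bound on one ball is available; a fixed
    number of steps spreads it over a whole later space. So tightness is obtained from some time k
    on, at the cost of boundedly many terms.

    Cases (A) and (B) meet in [mixing_system], whose laws for expectations cover Hoelder functions
    only; this is why tightness is tested with Lipschitz cutoffs instead of indicators. *)

Section hoelder_functions.
Context (R : realType) (beta : R).

(** A single real constant bounds both the supremum and the Hoelder quotient. Up to a factor 2 this
    is a bound on [hoelder_norm], without extended reals. *)
Definition hoelder_le (M : pmetricType R) (C : R) (g : M -> R) :=
  (forall x, `|g x| <= C) /\
  (forall x y, `|g x - g y| <= C * mdist x y `^ beta).

Definition hoelder_fun (M : pmetricType R) (g : M -> R) := exists C, hoelder_le C g.

Context (M : pmetricType R).
Implicit Types (C : R) (f g : M -> R).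

Lemma hoelder_le_ge0 C g : hoelder_le C g -> 0 <= C.
Proof. by move=> [/(_ point) + _]; apply: le_trans. Qed.

Lemma hoelder_leW C C' g : C <= C' -> hoelder_le C g -> hoelder_le C' g.
Proof.
move=> CC' [h1 h2]; split=> [x|x y]; first exact: le_trans (h1 x) CC'.
by apply: le_trans (h2 x y) _; rewrite ler_wpM2r// powR_ge0.
Qed.

Lemma hoelder_cst (a : R) : hoelder_le `|a| (fun _ : M => a).
Proof.
by split=> // x y; rewrite subrr normr0 mulr_ge0// powR_ge0.
Qed.

Lemma hoelder_leD C C' f g : hoelder_le C f -> hoelder_le C' g ->
  hoelder_le (C + C') (fun x => f x + g x).
Proof.
move=> [f1 f2] [g1 g2]; split=> [x|x y].
  by apply: le_trans (ler_normD _ _) _; exact: lerD.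
have -> : f x + g x - (f y + g y) = (f x - f y) + (g x - g y) by ring.
by rewrite mulrDl; apply: le_trans (ler_normD _ _) _; exact: lerD.
Qed.

Lemma hoelder_leZ (a : R) C f : hoelder_le C f ->
  hoelder_le (`|a| * C) (fun x => a * f x).
Proof.
move=> [f1 f2]; split=> [x|x y]; first by rewrite normrM ler_wpM2l.
by rewrite -mulrBr normrM -mulrA ler_wpM2l.
Qed.

Lemma hoelder_leM C C' f g : hoelder_le C f -> hoelder_le C' g ->
  hoelder_le (2 * C * C') (fun x => f x * g x).
Proof.
move=> hf hg; have C0 := hoelder_le_ge0 hf; have C'0 := hoelder_le_ge0 hg.
case: hf hg => [f1 f2] [g1 g2]; split=> [x|x y].
  rewrite normrM; apply: (@le_trans _ _ (C * C')); first exact: ler_pM.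
  by rewrite -mulrA ler_peMl ?mulr_ge0// ler1n.
have -> : f x * g x - f y * g y = (f x - f y) * g x + f y * (g x - g y) by ring.
apply: le_trans (ler_normD _ _) _; rewrite !normrM.
have -> : 2 * C * C' * mdist x y `^ beta =
  (C * mdist x y `^ beta) * C' + C * (C' * mdist x y `^ beta) by ring.
by apply: lerD; apply: ler_pM.
Qed.

Lemma hoelder_le_sum n (c : 'I_n -> R) (g : 'I_n -> M -> R) :
  (forall i, hoelder_le (c i) (g i)) ->
  hoelder_le (\sum_(i < n) c i) (fun x => \sum_(i < n) g i x).
Proof.
elim: n c g => [|n IH] c g hg.
  by split=> [x|x y]; rewrite !big_ord0 ?subrr ?mul0r normr0.
rewrite big_ord_recr /=.
have -> : (fun x => \sum_(i < n.+1) g i x) =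
    (fun x => \sum_(i < n) g (widen_ord (leqnSn n) i) x + g ord_max x).
  by apply/funext=> x; rewrite big_ord_recr.
by apply: hoelder_leD (hg _); apply: IH => i; exact: hg.
Qed.

Lemma hoelder_le_lipschitz (L b C : R) (u : R -> R) g : 0 <= L ->
  (forall t, `|u t| <= b) -> (forall s t, `|u s - u t| <= L * `|s - t|) ->
  hoelder_le C g -> hoelder_le (b + L * C) (u \o g).
Proof.
move=> L0 ub uL hg; have C0 := hoelder_le_ge0 hg; case: hg => [g1 g2].
have b0 : 0 <= b by apply: le_trans (ub 0).
split=> [x|x y] /=; first by apply: le_trans (ub _) _; rewrite lerDl mulr_ge0.
apply: le_trans (uL _ _) _.
apply: (@le_trans _ _ (L * (C * mdist x y `^ beta))); first by rewrite ler_wpM2l.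
by rewrite mulrDl mulrA lerDr mulr_ge0// powR_ge0.
Qed.

Lemma hoelder_const (a : R) : hoelder_fun (fun _ : M => a).
Proof. by exists `|a|; exact: hoelder_cst. Qed.

Lemma hoelderD f g : hoelder_fun f -> hoelder_fun g -> hoelder_fun (fun x => f x + g x).
Proof. by move=> [C hf] [C' hg]; exists (C + C'); exact: hoelder_leD. Qed.

Lemma hoelderZ (a : R) f : hoelder_fun f -> hoelder_fun (fun x => a * f x).
Proof. by move=> [C hf]; exists (`|a| * C); exact: hoelder_leZ. Qed.

Lemma hoelderM f g : hoelder_fun f -> hoelder_fun g -> hoelder_fun (fun x => f x * g x).
Proof. by move=> [C hf] [C' hg]; exists (2 * C * C'); exact: hoelder_leM. Qed.

Lemma hoelderX f n : hoelder_fun f -> hoelder_fun (fun x => f x ^+ n).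
Proof.
move=> hf; elim: n => [|n IH]; first exact: hoelder_const.
have -> : (fun x => f x ^+ n.+1) = (fun x => f x * f x ^+ n).
  by apply/funext=> x; rewrite exprS.
exact: hoelderM.
Qed.

End hoelder_functions.

Section hoelder_compositions.
Context (R : realType) (beta : R).
Hypothesis beta_gt0 : 0 < beta.

Lemma hoelder_le_comp (M N : pmetricType R) (K C : R) (T : M -> N) (u : N -> R) :
  lipschitz_le K T -> hoelder_le beta C u ->
  hoelder_le beta (Num.max K 1 `^ beta * C) (u \o T).
Proof.
move=> TK hu; have C0 := hoelder_le_ge0 hu; case: hu => [u1 u2].
have K1 : 1 <= Num.max K 1 by rewrite le_max lexx orbT.
have K0 : 0 <= Num.max K 1 by apply: le_trans K1.
have Kb : 1 <= Num.max K 1 `^ beta.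
  by rewrite -[X in X <= _](powRr0 (Num.max K 1)) ler_powR// ltW.
split=> [x|x y] /=; first by apply: le_trans (u1 _) _; rewrite ler_peMl.
apply: le_trans (u2 _ _) _.
rewrite mulrAC [X in _ <= X]mulrC ler_wpM2l// -powRM//; last exact: mdist_ge0.
rewrite ge0_ler_powR ?nnegrE ?mulr_ge0 ?mdist_ge0 ?(ltW beta_gt0)//.
apply: le_trans (TK x y) _.
by rewrite ler_wpM2r ?mdist_ge0// le_max lexx.
Qed.

(** The radius is chosen before the space and the function: this is the equicontinuity, uniform in
    time, behind all passages from small averages to small suprema. *)
Lemma hoelder_modulus (C eps : R) : 0 <= C -> 0 < eps ->
  exists2 rho, 0 < rho & forall (M : pmetricType R) (g : M -> R) x y,
    hoelder_le beta C g -> mdist x y < rho -> `|g x - g y| < eps.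
Proof.
move=> C0 eps0; have C10 : 0 < C + 1 by rewrite ltr_wpDl.
pose u := eps / (C + 1); have u0 : 0 < u by rewrite divr_gt0.
pose rho := u `^ beta^-1.
have rho0 : 0 < rho by exact: powR_gt0.
have rhoE : rho `^ beta = u by rewrite -powRrM mulVf ?gt_eqF// powRr1// ltW.
exists rho => // M g x y [_ /(_ x y) gxy] xy; apply: le_lt_trans gxy _.
apply: (@le_lt_trans _ _ (C * u)).
  rewrite ler_wpM2l// -rhoE ge0_ler_powR ?nnegrE ?mdist_ge0 ?(ltW beta_gt0)//;
    exact: ltW.
rewrite /u mulrA ltr_pdivrMr// mulrC mulrDr mulr1 ltrDl//.
Qed.

End hoelder_compositions.

(** Recursion from time m, with irrelevant values [d] before m. Orbits and iterates of the dual
    operators thus live on absolute times, and composites need no casts. *)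
Lemma family_from (U : nat -> Type) (step : forall n, U n -> U n.+1)
    (d : forall n, U n) (m : nat) (u : U m) :
  exists G : forall n, U n, G m = u /\
    forall n, (m <= n)%N -> G n.+1 = step n (G n).
Proof.
elim: m U step d u => [|m IH] U step d u.
  by exists (fun n => nat_rect U u step n).
have [G [Gm Gs]] := IH (fun n => U n.+1) (fun n => step n.+1) (fun n => d n.+1) u.
exists (fun n => match n with 0 => d 0%N | k.+1 => G k end).
by split=> // -[|n]//; exact: Gs.
Qed.

Lemma geometric_sum_le (R : realType) (d : R) n : 0 < d < 1 ->
  \sum_(k < n) d ^+ (n - k) <= (1 - d)^-1.
Proof.
move=> /andP[d0 d1]; have d1' : 0 < 1 - d by rewrite subr_gt0.
elim: n => [|n IH]; first by rewrite big_ord0 invr_ge0 ltW.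
rewrite big_ord_recr /= subSnn expr1.
have -> : \sum_(i < n) d ^+ (n.+1 - i) = d * \sum_(i < n) d ^+ (n - i).
  by rewrite mulr_sumr; apply: eq_bigr => i _; rewrite subSn ?exprS// ltnW.
apply: (@le_trans _ _ (d * (1 - d)^-1 + d)); first by rewrite lerD2r ler_pM2l.
rewrite -(ler_pM2r d1') mulrDl mulfVK ?gt_eqF// mulVf ?gt_eqF//.
by have := sqr_ge0 (1 - d); lra.
Qed.

(** * Mixing systems *)

(* [dual] is the transfer operator normalized to fix the constant 1, and
   [expect] is integration against the equivariant measures.  [mixing] is
   stated for families G with [G n.+1 = dual (G n)] rather than for iterates of
   [dual]: this keeps all indices of the form n.+1 and avoids casts. *)
Record mixing_system (R : realType) (beta : R) (Y : nat -> pmetricType R)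
    (T : forall n, Y n -> Y n.+1) := MixingSystem {
  expect : forall n, (Y n -> R) -> R;
  dual : forall n, (Y n -> R) -> Y n.+1 -> R;
  lip_const : R;
  weight_inf : R;
  mix_const : R;
  mix_rate : R;
  expectPZ : forall n a (f g : Y n -> R), hoelder_fun beta f ->
    hoelder_fun beta g ->
    expect (fun x => a * f x + g x) = a * expect f + expect g;
  expect_ge0 : forall n (f : Y n -> R), hoelder_fun beta f ->
    (forall x, 0 <= f x) -> 0 <= expect f;
  expect1 : forall n, expect (fun _ : Y n => 1) = 1;
  hoelder_le_pull : forall n C (u : Y n.+1 -> R), hoelder_le beta C u ->
    hoelder_le beta (lip_const * C) (fun x => u (T n x));
  dualPZ : forall n a (f g : Y n -> R) x,
    dual (fun y => a * f y + g y) x = a * dual f x + dual g x;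
  weight_inf_gt0 : 0 < weight_inf;
  dual_ge : forall n (f : Y n -> R) y, (forall x, 0 <= f x) ->
    weight_inf * f y <= dual f (T n y);
  dual_ge0 : forall n (f : Y n -> R) x, (forall y, 0 <= f y) -> 0 <= dual f x;
  dual_pull : forall n u (g : Y n -> R) x,
    dual (fun y => u (T n y) * g y) x = u x * dual g x;
  dual1 : forall n x, dual (fun _ : Y n => 1) x = 1;
  hoelder_dual : forall n (g : Y n -> R), hoelder_fun beta g ->
    hoelder_fun beta (dual g);
  expect_dual : forall n (g : Y n -> R), hoelder_fun beta g ->
    expect (dual g) = expect g;
  mix_const_gt0 : 0 < mix_const;
  mix_rate_itv : 0 < mix_rate < 1;
  mixing : forall m (G : forall n, Y n -> R) c,
    (forall n, (m <= n)%N -> G n.+1 = dual (G n)) -> hoelder_le beta c (G m) ->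
    forall n, (m <= n)%N -> hoelder_le beta (mix_const * mix_rate ^+ (n - m) * c)
      (fun x => G n x - expect (G m))
}.

Section birkhoff_sums.
Context (R : realType) (Y : nat -> pmetricType R) (T : forall n, Y n -> Y n.+1).

(* [bsum l m F] is the sum of F (m + i) o T_m^i over i < l, unfolded from the
   left so that no composite T_m^i (hence no cast) appears. *)
Fixpoint bsum (l m : nat) (F : forall n, Y n -> R) (x : Y m) : R :=
  match l with
  | 0 => 0
  | l'.+1 => F m x + bsum l' F (T x)
  end.

Fixpoint orbit_at (k : nat) (x : Y 0) : Y k :=
  match k with
  | 0 => x
  | k'.+1 => T (orbit_at k' x)
  end.

Lemma eq_bsum l m (F G : forall n, Y n -> R) (x : Y m) :
  (forall n x, (m <= n)%N -> F n x = G n x) -> bsum l F x = bsum l G x.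
Proof.
elim: l m x => //= l IH m x FG; rewrite FG// IH// => n y mn.
by apply: FG; exact: ltnW.
Qed.

Lemma bsumD l m (F G : forall n, Y n -> R) (x : Y m) :
  bsum l (fun n x => F n x + G n x) x = bsum l F x + bsum l G x.
Proof. by elim: l m x => [|l IH] m x /=; rewrite ?addr0// IH; ring. Qed.

Lemma bsum_cst l m (c : nat -> R) (x : Y m) :
  bsum l (fun n _ => c n) x = \sum_(i < l) c (i + m)%N.
Proof.
elim: l m x => [|l IH] m x /=; first by rewrite big_ord0.
by rewrite IH big_ord_recl; congr (_ + _); apply: eq_bigr => i _; rewrite addnS.
Qed.

(** The sum telescopes. The end term is v at time m + l composed with l maps; it is hidden behind
    [vl], because only its supremum bound is used. *)
Lemma bsum_coboundary l m (v : forall n, Y n -> R) : exists vl : Y m -> R,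
  (forall C, (forall n x, `|v n x| <= C) -> forall x, `|vl x| <= C) /\
  forall x, bsum l (fun n x => v n.+1 (T x) - v n x) x = vl x - v m x.
Proof.
elim: l m => [|l IH] m /=; first by exists (v m); split=> // x; rewrite subrr.
have [vl [vlC vlE]] := IH m.+1.
exists (fun x => vl (T x)); split=> [C vC x|x]; first exact: vlC.
by rewrite vlE; ring.
Qed.

Lemma bsum_le l m (F : forall n, Y n -> R) C (x : Y m) :
  (forall n x, `|F n x| <= C) -> `|bsum l F x| <= l%:R * C.
Proof.
move=> FC; elim: l m x => [|l IH] m x /=; first by rewrite normr0 mul0r.
rewrite -natr1 mulrDl mul1r addrC; apply: le_trans (ler_normD _ _) _.
exact: lerD.
Qed.

Lemma bsum_orbit k l (F : forall n, Y n -> R) (x : Y 0) :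
  \sum_(j < k + l) F j (orbit_at j x) =
  \sum_(j < k) F j (orbit_at j x) + bsum l F (orbit_at k x).
Proof.
elim: l k => [|l IH] k /=; first by rewrite addn0 addr0.
by rewrite addnS -addSn IH big_ord_recr /= addrA.
Qed.

End birkhoff_sums.

Fixpoint psum (R : realType) (e : nat -> R) (l m : nat) : R :=
  match l with 0 => 0 | l'.+1 => e m + psum e l' m.+1 end.

(** The discounted sum of d^i e_(m+i) over i < l. It measures the correlation of a function at time
    m with future variances. *)
Fixpoint dsum (R : realType) (d : R) (e : nat -> R) (l m : nat) : R :=
  match l with 0 => 0 | l'.+1 => e m + d * dsum d e l' m.+1 end.

Section expectation.
Context (R : realType) (beta : R) (Y : nat -> pmetricType R).
Context (T : forall n, Y n -> Y n.+1) (S : mixing_system beta T).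
Local Notation E := (expect S).
Local Notation P := (dual S).

Lemma hoelder_pull n (u : Y n.+1 -> R) : hoelder_fun beta u ->
  hoelder_fun beta (fun x => u (T x)).
Proof.
by move=> [C hu]; exists (lip_const S * C); exact: (hoelder_le_pull S).
Qed.

Lemma expect0 n : E (fun _ : Y n => 0) = 0.
Proof.
have h1 := hoelder_const beta (Y n) 1.
have := expectPZ S (-1) h1 h1.
rewrite expect1 (_ : (fun _ => _) = fun=> 0); first by move=> ->; ring.
by apply/funext=> x; ring.
Qed.

Lemma expectZ n a (f : Y n -> R) : hoelder_fun beta f ->
  E (fun x => a * f x) = a * E f.
Proof.
move=> hf; have := expectPZ S a hf (hoelder_const beta _ 0).
by rewrite expect0 addr0 => <-; congr (E _); apply/funext=> x; rewrite addr0.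
Qed.

Lemma expectD n (f g : Y n -> R) : hoelder_fun beta f -> hoelder_fun beta g ->
  E (fun x => f x + g x) = E f + E g.
Proof.
move=> hf hg; have := expectPZ S 1 hf hg.
by rewrite mul1r => <-; congr (E _); apply/funext=> x; rewrite mul1r.
Qed.

Lemma expect_cst n (a : R) : E (fun _ : Y n => a) = a.
Proof.
by have := expectZ a (hoelder_const beta (Y n) 1); rewrite expect1 !mulr1.
Qed.

Lemma expect_le n (f g : Y n -> R) : hoelder_fun beta f -> hoelder_fun beta g ->
  (forall x, f x <= g x) -> E f <= E g.
Proof.
move=> hf hg fg; have h : hoelder_fun beta (fun x => g x + (-1) * f x).
  by apply: hoelderD => //; exact: hoelderZ.
have := expect_ge0 S h; rewrite expectD ?expectZ//; last exact: hoelderZ.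
by rewrite mulN1r subr_ge0; apply=> x; rewrite mulN1r subr_ge0.
Qed.

Lemma expect_norm_le n (f : Y n -> R) C : hoelder_fun beta f ->
  (forall x, `|f x| <= C) -> `|E f| <= C.
Proof.
move=> hf fC; rewrite ler_norml; apply/andP; split.
  rewrite -(expect_cst n (- C)); apply: expect_le => //.
    exact: hoelder_const.
  by move=> x; have := fC x; rewrite ler_norml => /andP[].
rewrite -[X in _ <= X](expect_cst n C); apply: expect_le => //.
  exact: hoelder_const.
by move=> x; have := fC x; rewrite ler_norml => /andP[].
Qed.

Lemma expect_pullM n (u : Y n.+1 -> R) (g : Y n -> R) : hoelder_fun beta u ->
  hoelder_fun beta g ->
  E (fun x => u (T x) * g x) = E (fun z => u z * P g z).
Proof.
move=> hu hg.
rewrite -(expect_dual S (g := fun x => u (T x) * g x)); last first.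
  by apply: hoelderM => //; exact: hoelder_pull.
by congr (E _); apply/funext=> z; rewrite dual_pull.
Qed.

Lemma expect_pull n (u : Y n.+1 -> R) : hoelder_fun beta u ->
  E (fun x => u (T x)) = E u.
Proof.
move=> hu; have := expect_pullM hu (hoelder_const beta (Y n) 1).
rewrite (_ : (fun x => u (T x) * 1) = fun x => u (T x)).
  move=> ->; congr (E _); apply/funext=> x; by rewrite dual1 mulr1.
by apply/funext=> x; rewrite mulr1.
Qed.

Lemma dual0 n x : P (fun _ : Y n => 0) x = 0.
Proof.
have := dualPZ S (-1) (fun _ : Y n => 1) (fun=> 1) x.
rewrite dual1 (_ : (fun _ => _) = fun=> 0); first by move=> ->; ring.
by apply/funext=> y; ring.
Qed.

Lemma dualD n (f g : Y n -> R) x : P (fun y => f y + g y) x = P f x + P g x.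
Proof.
have := dualPZ S 1 f g x.
by rewrite mul1r => <-; congr (P _ _); apply/funext=> y; rewrite mul1r.
Qed.

Lemma dualZ n a (f : Y n -> R) x : P (fun y => a * f y) x = a * P f x.
Proof.
have := dualPZ S a f (fun=> 0) x.
by rewrite dual0 addr0 => <-; congr (P _ _); apply/funext=> y; rewrite addr0.
Qed.

Lemma dual_cst n a x : P (fun _ : Y n => a) x = a.
Proof.
by have := dualZ a (fun _ : Y n => 1) x; rewrite dual1 !mulr1.
Qed.

Lemma dual_comp n (u : Y n.+1 -> R) x : P (fun y => u (T y)) x = u x.
Proof.
have := dual_pull S u (fun _ : Y n => 1) x; rewrite dual1 mulr1 => <-.
by congr (P _ _); apply/funext=> y; rewrite mulr1.
Qed.

Lemma dual_sum n k (g : 'I_k -> Y n -> R) x :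
  P (fun y => \sum_(i < k) g i y) x = \sum_(i < k) P (g i) x.
Proof.
elim: k g => [|k IH] g.
  rewrite big_ord0 -[RHS](dual0 x); congr (P _ _).
  by apply/funext=> y; rewrite big_ord0.
rewrite big_ord_recr /= -IH -dualD; congr (P _ _).
by apply/funext=> y; rewrite big_ord_recr.
Qed.

Lemma dual_le n (f g : Y n -> R) x : (forall y, f y <= g y) -> P f x <= P g x.
Proof.
move=> fg; rewrite -subr_ge0 -mulN1r -dualZ -dualD; apply: dual_ge0 => y.
by rewrite mulN1r subr_ge0.
Qed.

Lemma dual_family m (g : Y m -> R) : exists G : forall n, Y n -> R,
  G m = g /\ forall n, (m <= n)%N -> G n.+1 = P (G n).
Proof.
exact: (family_from (fun n (g : Y n -> R) => P g) (fun n _ => 0)).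
Qed.

Lemma hoelder_bsum l m (F : forall n, Y n -> R) :
  (forall n, hoelder_fun beta (F n)) -> hoelder_fun beta (@bsum _ _ T l m F).
Proof.
move=> hF; elim: l m => [|l IH] m /=; first exact: hoelder_const.
by apply: hoelderD => //; exact: hoelder_pull.
Qed.

(* [v n] is the sum over k < n of the images of [F k - E (F k)] under the dual
   operators from time k to time n. *)
Lemma martingale_decomposition (F : forall n, Y n -> R) B :
  (forall n, hoelder_le beta B (F n)) ->
  exists C (D v : forall n, Y n -> R),
  [/\ forall n, hoelder_le beta C (D n), forall n, hoelder_le beta C (v n),
      forall n x, P (D n) x = 0 &
      forall n x, F n x = E (F n) + D n x + (v n.+1 (T x) - v n x)].
Proof.
move=> hF.
have B0 : 0 <= B by exact: hoelder_le_ge0 (hF 0).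
have hF' n : hoelder_fun beta (F n) by exists B.
have hFc n : hoelder_le beta (B + B) (fun x => F n x + - E (F n)).
  apply: hoelder_leD => //; apply: hoelder_leW (hoelder_cst beta _ _).
  by rewrite normrN; apply: expect_norm_le => // x; case: (hF n).
have EFc n : E (fun x => F n x + - E (F n)) = 0.
  by rewrite expectD ?expect_cst ?subrr//; exact: hoelder_const.
have [G GE] := choice (fun k => dual_family (fun x => F k x + - E (F k))).
pose v n x := \sum_(k < n) G k n x.
set d := mix_rate S; set c := mix_const S.
have c0 : 0 < c := mix_const_gt0 S.
have d01 : 0 < d < 1 := mix_rate_itv S.
pose Cv := c * (B + B) * (1 - d)^-1.
have hv n : hoelder_le beta Cv (v n).
  (* Centring makes the limit in [mixing] zero, so the summands of v decay geometrically. *)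
  have hk (k : 'I_n) : hoelder_le beta (c * d ^+ (n - k) * (B + B)) (G k n).
    have [Gk Gs] := GE k.
    have hGk : hoelder_le beta (B + B) (G k k) by rewrite Gk.
    have := mixing Gs hGk (ltnW (ltn_ord k)).
    rewrite Gk EFc; congr hoelder_le.
    by apply/funext=> x; rewrite subr0.
  apply: hoelder_leW (hoelder_le_sum hk).
  rewrite -mulr_suml -mulr_sumr mulrAC -/Cv /Cv ler_wpM2l//.
    by apply: mulr_ge0; [exact: ltW | exact: addr_ge0].
  exact: geometric_sum_le.
(* This recursion, with the fact that the dual undoes composition with T, gives P D = 0. *)
have vS n x : v n.+1 x = P (fun y => (F n y + - E (F n)) + v n y) x.
  rewrite dualD dual_sum /v big_ord_recr /= [RHS]addrC; congr (_ + _).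
    by apply: eq_bigr => i _; have [_ ->] := GE i; rewrite // ltnW.
  by have [Gk ->] := GE n; rewrite ?Gk.
pose D n x := (F n x + - E (F n)) + v n x + (-1) * v n.+1 (T x).
have hD n : hoelder_le beta (B + B + Cv + `|-1| * (lip_const S * Cv)) (D n).
  apply: hoelder_leD; first exact: hoelder_leD.
  by apply: hoelder_leZ; exact: (hoelder_le_pull S).
exists (B + B + Cv + `|-1| * (lip_const S * Cv)), D, v; split=> //.
- move=> n; apply: hoelder_leW (hv n).
  have h1 := hoelder_le_ge0 (hoelder_le_pull S (hv 1)).
  by rewrite normrN1 mul1r; lra.
- by move=> n x; rewrite /D dualD dualZ -vS (dual_comp (v n.+1)); ring.
- by move=> n x; rewrite /D; ring.
Qed.

End expectation.

(** * Moments of reverse martingale sums *)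

Section moments.
Context (R : realType) (beta : R) (Y : nat -> pmetricType R).
Context (T : forall n, Y n -> Y n.+1) (S : mixing_system beta T).
Local Notation E := (expect S).
Local Notation P := (dual S).
Context (D : forall n, Y n -> R) (B : R).
Hypothesis hD : forall n, hoelder_le beta B (@D n).
Hypothesis PD : forall n x, P (@D n) x = 0.

Let N l m : Y m -> R := @bsum _ _ T l m D.
Let e n := E (fun y : Y n => D y ^+ 2).
(** Composed with T, this is the conditional variance of D n given T. *)
Let q n : Y n.+1 -> R := P (fun y : Y n => D y ^+ 2).
(** The conditional quadratic variation of the reverse martingale sum [N]. *)
Let A l m : Y m -> R := @bsum _ _ T l m (fun n x => q (T x)).

Let hD' n : hoelder_fun beta (@D n). Proof. by exists B. Qed.
Let hN l m : hoelder_fun beta (@N l m).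
Proof. exact: (hoelder_bsum S). Qed.
Let hq n : hoelder_fun beta (@q n).
Proof. by apply: (hoelder_dual S); exact: hoelderX. Qed.
Let hA l m : hoelder_fun beta (@A l m).
Proof. by apply: (hoelder_bsum S) => n; exact: (hoelder_pull S (@hq n)). Qed.
Let B0 : 0 <= B. Proof. exact: hoelder_le_ge0 (hD 0). Qed.

Local Ltac hoelder_side := repeat (first
  [ done | eassumption | exact: hD' | exact: hN | exact: hq | exact: hA
  | exact: (hoelder_pull S (@hN _ _)) | exact: (hoelder_pull S (@hq _))
  | exact: (hoelder_pull S (@hA _ _))
  | match goal with
    | |- hoelder_fun _ (fun x => _ + _) => apply: hoelderD
    | |- hoelder_fun _ (fun x => _ ^+ _) => apply: hoelderX
    | |- hoelder_fun _ (fun x => ?a * _) => apply: hoelderZ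
    | |- hoelder_fun _ (fun x => _ * _) => apply: hoelderM
    | |- hoelder_fun _ (fun x => ?a) => apply: hoelder_const
    | |- hoelder_fun _ (dual _ _) => apply: hoelder_dual
    end ]).

Let DB n (x : Y n) : D x ^+ 2 <= B ^+ 2.
Proof.
rewrite -real_normK ?num_real// ler_sqr ?nnegrE//.
by case: (hD n) => + _; apply.
Qed.

Let Eq n : E (@q n) = e n.
Proof. by rewrite expect_dual//; exact: hoelderX. Qed.

Let e0 n : 0 <= e n.
Proof. by apply: (expect_ge0 S) => [|x]; [exact: hoelderX | exact: sqr_ge0]. Qed.

Let a0 l m : 0 <= psum e l m.
Proof. by elim: l m => //= l IH m; rewrite addr_ge0. Qed.

Let q0 n (x : Y n.+1) : 0 <= @q n x.
Proof. by apply: (dual_ge0 S) => y; exact: sqr_ge0. Qed.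

Let A0 l m (x : Y m) : 0 <= @A l m x.
Proof.
by elim: l m x => //= l IH m x; apply: addr_ge0; [exact: q0 | exact: IH].
Qed.

(** Orthogonality: a function of T x can be taken out of the dual operator, and P D = 0 kills the
    cross terms. *)
Lemma second_moment_bsum l m : E (fun x => @bsum _ _ T l m D x ^+ 2) = psum e l m.
Proof.
elim: l m => [|l IH] m /=.
  by rewrite (_ : (fun _ => _) = fun=> 0) ?expect0//; apply/funext=> x; ring.
have -> : (fun x : Y m => (D x + bsum T l D (T x)) ^+ 2) =
  (fun x => D x ^+ 2 + (2 * (N l (T x) * D x) + N l (T x) ^+ 2)).
  by apply/funext=> x; rewrite /N /=; ring.
rewrite expectD; [|hoelder_side..]; rewrite expectD; [|hoelder_side..].
rewrite expectZ; [|hoelder_side]; rewrite expect_pullM; [|hoelder_side..].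
have -> : (fun z => N l z * P (@D m) z) = fun=> 0.
  by apply/funext=> z; rewrite PD mulr0.
rewrite expect0 mulr0 add0r (expect_pull S (u := fun z => N l z ^+ 2)); last by hoelder_side.
by rewrite IH.
Qed.

Let EA l m : E (@A l m) = psum e l m.
Proof.
elim: l m => [|l IH] m /=; first exact: (expect0 S).
have := expectD S (hoelder_pull S (@hq m)) (hoelder_pull S (@hA l m.+1)).
rewrite /A /= => ->.
by rewrite (expect_pull S (@hq m)) (expect_pull S (@hA l m.+1)) Eq IH.
Qed.

Let d := mix_rate S.
Let d01 : 0 < d < 1 := mix_rate_itv S.
Let d0 : 0 <= d. Proof. by case/andP: d01 => /ltW. Qed.

Let W0 l m : 0 <= dsum d e l m.
Proof. by elim: l m => //= l IH m; rewrite addr_ge0// mulr_ge0. Qed.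

(** Duality replaces G at time m by its image at each later time, which is small in supremum. As q
    >= 0, this bounds each correlation by a multiple of E q = e. Linearity in e is essential:
    Hoelder norms of q would only give a bound linear in the number l of terms. *)
Let decorrelation l m (G : forall n, Y n -> R) (c : R) :
  (forall n, (m <= n)%N -> G n.+1 = P (G n)) -> hoelder_fun beta (G m) ->
  0 <= c ->
  (forall n x, (m <= n)%N -> `|G n x| <= c * d ^+ (n - m)) ->
  `|E (fun x => G m x * @A l m x)| <= c * dsum d e l m.
Proof.
elim: l m c => [|l IH] m c GS hG c0 Gc /=.
  rewrite (_ : (fun _ => _) = fun=> 0) ?expect0 ?normr0 ?mulr0//.
  by apply/funext=> x; rewrite mulr0.
have hGS : hoelder_fun beta (G m.+1) by rewrite GS//; exact: hoelder_dual.
have hqA : hoelder_fun beta (fun z => @q m z + @A l m.+1 z) by exact: hoelderD.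
have -> : E (fun x => G m x * @A l.+1 m x) =
    E (fun z => G m.+1 z * @q m z) + E (fun z => G m.+1 z * @A l m.+1 z).
  rewrite -expectD; [|exact: hoelderM..].
  have -> : (fun x => G m x * @A l.+1 m x) =
      (fun x => (@q m (T x) + @A l m.+1 (T x)) * G m x).
    by apply/funext=> x; rewrite /A /= mulrC.
  rewrite (expect_pullM S hqA hG); congr (E _); apply/funext=> z.
  by rewrite -GS//; ring.
apply: le_trans (ler_normD _ _) _; rewrite mulrDr; apply: lerD.
  rewrite -Eq -expectZ// ler_norml -mulN1r -expectZ; last exact: hoelderZ.
  have Gb z : `|G m.+1 z| <= c.
    apply: le_trans (Gc _ _ (leqnSn _)) _.
    by rewrite subSnn expr1 ler_piMr//; case/andP: d01 => _ /ltW.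
  apply/andP; split; (apply: expect_le; [hoelder_side|hoelder_side|]) => z.
    by rewrite mulrA mulN1r ler_wpM2r//; have := Gb z; rewrite ler_norml => /andP[].
  by rewrite ler_wpM2r//; have := Gb z; rewrite ler_norml => /andP[].
rewrite mulrA; apply: IH => //.
- by move=> n mn; apply: GS; exact: ltnW.
- by rewrite mulr_ge0.
- move=> n x mn; apply: le_trans (Gc _ _ (ltnW mn)) _.
  by rewrite -mulrA -exprS subnSK.
Qed.

Let K2 := 2 * (mix_const S * (2 * B * B)) / (1 - d).

Let K20 : 0 <= K2.
Proof.
have c0 := ltW (mix_const_gt0 S); have /andP[_ d1] := d01.
by rewrite /K2 divr_ge0// ?subr_ge0 ?(ltW d1)// !mulr_ge0.
Qed.

Let EqA l m : E (fun z => @q m z * @A l m.+1 z) <=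
  mix_const S * (2 * B * B) * dsum d e l m.+1 + e m * psum e l m.+1.
Proof.
have [G [Gm GS]] := dual_family S (fun y : Y m => D y ^+ 2).
have hGm : hoelder_le beta (2 * B * B) (G m).
  by rewrite Gm; exact: (hoelder_leM (hD m) (hD m)).
have mixG := mixing GS hGm.
have hG n : (m <= n)%N -> hoelder_fun beta (G n).
  elim: n => [|n IH]; first by rewrite leqn0 => /eqP <-; exists (2 * B * B).
  rewrite leq_eqVlt => /orP[/eqP <-|mn]; first by exists (2 * B * B).
  by rewrite GS//; apply: (hoelder_dual S); exact: IH.
(* At time m+1 this is q minus its mean, and [mixing] makes its later images decay. *)
pose G' n x := G n x + - e m.
have c0 : 0 <= mix_const S * (2 * B * B).
  by rewrite !mulr_ge0// ltW// mix_const_gt0.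
have G'b n x : (m.+1 <= n)%N ->
    `|G' n x| <= mix_const S * (2 * B * B) * d ^+ (n - m.+1).
  move=> mn; have [+ _] := mixG n (ltnW mn); rewrite {1}Gm => /(_ x) /le_trans; apply.
  rewrite mulrAC ler_wpM2l// ler_wiXn2l//; last by rewrite leq_sub2l.
  by case/andP: d01 => _ /ltW.
have G'S n : (m.+1 <= n)%N -> G' n.+1 = P (G' n).
  move=> mn; apply/funext=> x; rewrite /G' GS; last exact: ltnW.
  by rewrite dualD dual_cst.
have hG' : hoelder_fun beta (G' m.+1).
  by apply: hoelderD; [exact: hG | exact: hoelder_const].
have := decorrelation l G'S hG' c0 G'b => /ler_normlP [_ H].
have -> : (fun z => @q m z * @A l m.+1 z) =
    (fun z => G' m.+1 z * @A l m.+1 z + e m * @A l m.+1 z).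
  by apply/funext=> z; rewrite /G' GS// Gm /q; ring.
rewrite expectD; [|exact: hoelderM|exact: hoelderZ].
by rewrite expectZ// EA lerD2r.
Qed.

(** The negative [dsum] term serves the induction. Passing from m+1 to m replaces w by e m + d w,
    which frees K2 (1 - d) w; [K2] is chosen so that this is exactly the correlation term of 2 E (q
    A) in [EqA]. *)
Let EA2 l m : E (fun x => @A l m x ^+ 2) <=
  psum e l m ^+ 2 + (K2 + B ^+ 2) * psum e l m - K2 * dsum d e l m.
Proof.
elim: l m => [|l IH] m /=.
  rewrite (_ : (fun _ => _) = fun=> 0) ?expect0; first by rewrite !mulr0; lra.
  by apply/funext=> x; rewrite /A /=; ring.
have hAq : hoelder_fun beta (fun z => (@q m z + @A l m.+1 z) ^+ 2).
  by apply: hoelderX; exact: hoelderD.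
have -> : E (fun x => @A l.+1 m x ^+ 2) = E (fun z => @q m z ^+ 2) +
    (2 * E (fun z => @q m z * @A l m.+1 z) + E (fun z => @A l m.+1 z ^+ 2)).
  rewrite -expectZ; [|hoelder_side]; rewrite -expectD; [|hoelder_side..].
  rewrite -expectD; [|hoelder_side..].
  rewrite -(expect_pull S (n := m)); [|hoelder_side].
  by congr (E _); apply/funext=> x; rewrite /A /=; ring.
have q2 : E (fun z => @q m z ^+ 2) <= B ^+ 2 * e m.
  rewrite -Eq -expectZ; [|hoelder_side]; apply: expect_le; [hoelder_side|hoelder_side|] => z.
  rewrite expr2 ler_wpM2r// -(dual_cst S (B ^+ 2) z).
  exact: (dual_le S).
have qA := EqA l m; have IHl := IH m.+1.
set a := psum e l m.+1 in qA IHl *; set w := dsum d e l m.+1 in qA IHl *.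
have K2E : K2 * (1 - d) = 2 * (mix_const S * (2 * B * B)).
  by rewrite /K2 divfK// gt_eqF// subr_gt0; case/andP: d01.
have K2w : K2 * (1 - d) * w = 2 * (mix_const S * (2 * B * B)) * w by rewrite K2E.
have := sqr_ge0 (e m); move: K2w q2 qA IHl; rewrite -/a -/w.
lra.
Qed.

(* Expanding E N^4 produces the sum of the E (D_k^2 N_(k+1)^2).  Given T^(k+1),
   the conditional mean of N is N_(k+1) o T^(k+1), so by Jensen this sum is at
   most E (A N^2), and 8 A N^2 <= 32 A^2 + N^4 / 2 absorbs the fourth moment. *)
Lemma fourth_moment_bsum : exists2 K, 0 <= K & forall l m,
  E (fun x => @bsum _ _ T l m D x ^+ 4) <= K * (psum e l m ^+ 2 + psum e l m).
Proof.
have H l m : E (fun x : Y m => N l x ^+ 4) <=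
    3 * B ^+ 2 * psum e l m + 8 * E (fun x : Y m => A l x * N l x ^+ 2).
  elim: l m => [|l IH] m; rewrite [psum _ _ _]/=.
    have -> : (fun x : Y m => N 0 x ^+ 4) = fun=> 0.
      by apply/funext=> x; rewrite /N /= expr0n.
    have -> : (fun x : Y m => A 0 x * N 0 x ^+ 2) = fun=> 0.
      by apply/funext=> x; rewrite /A /= mul0r.
    by rewrite expect0 !mulr0 addr0.
  have AN : E (fun x : Y m => A l.+1 x * N l.+1 x ^+ 2) =
      E (fun z : Y m.+1 => (q z + A l z) * q z) +
      E (fun z : Y m.+1 => (q z + A l z) * N l z ^+ 2).
    have -> : (fun x : Y m => A l.+1 x * N l.+1 x ^+ 2) = fun x =>
        (q (T x) + A l (T x)) * D x ^+ 2 + (2 * ((q (T x) + A l (T x)) * N l (T x) * D x)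
        + (q (T x) + A l (T x)) * N l (T x) ^+ 2).
      by apply/funext=> x; rewrite /A /N /=; ring.
    rewrite expectD; [|hoelder_side..]; rewrite expectD; [|hoelder_side..].
    rewrite expectZ; [|hoelder_side].
    rewrite (expect_pullM S (u := fun z => q z + A l z)); [|hoelder_side..].
    rewrite (expect_pullM S (u := fun z => (q z + A l z) * N l z)); [|hoelder_side..].
    rewrite (expect_pull S (u := fun z => (q z + A l z) * N l z ^+ 2)); [|hoelder_side..].
    have -> : (fun z => (q z + A l z) * N l z * P (@D m) z) = fun=> 0.
      by apply/funext=> z; rewrite PD mulr0.
    by rewrite expect0 mulr0 add0r.
  have qq : 0 <= E (fun z : Y m.+1 => (q z + A l z) * q z).
    apply: (expect_ge0 S) => [|z]; first by hoelder_side.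
    by apply: mulr_ge0; [apply: addr_ge0; [exact: q0 | exact: A0] | exact: q0].
  have N4 : E (fun x : Y m => N l.+1 x ^+ 4) <= 3 * B ^+ 2 * e m +
      (8 * E (fun z : Y m.+1 => q z * N l z ^+ 2) + E (fun z : Y m.+1 => N l z ^+ 4)).
    have -> : E (fun z : Y m.+1 => q z * N l z ^+ 2) =
        E (fun x : Y m => N l (T x) ^+ 2 * D x ^+ 2).
      rewrite (expect_pullM S (u := fun z => N l z ^+ 2)); [|hoelder_side..].
      by congr (E _); apply/funext=> z; rewrite mulrC.
    (* In the expansion of (y + n)^4 the term 4 n^3 y has mean zero, and 4 y^3 n <= 2 y^4 + 2 y^2
       n^2 leaves 3 y^4 + 8 y^2 n^2 + n^4. *)
    have D3 : 0 = 4 * E (fun x : Y m => N l (T x) ^+ 3 * D x).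
      rewrite (expect_pullM S (u := fun z => N l z ^+ 3)); [|hoelder_side..].
      have -> : (fun z => N l z ^+ 3 * P (@D m) z) = fun=> 0.
        by apply/funext=> z; rewrite PD mulr0.
      by rewrite expect0 mulr0.
    rewrite -(expect_pull S (u := fun z => N l z ^+ 4)); [|hoelder_side].
    rewrite -[leRHS]addr0 [X in _ <= _ + X]D3.
    rewrite -!expectZ; [|hoelder_side..]; rewrite -!expectD; [|hoelder_side..].
    apply: expect_le; [hoelder_side|hoelder_side|] => x.
    rewrite /N /=; have := DB x; set y := D x; set n := bsum T l D (T x) => yB.
    have h1 : 3 * y ^+ 4 <= 3 * B ^+ 2 * y ^+ 2.
      have -> : 3 * y ^+ 4 = 3 * y ^+ 2 * y ^+ 2 by ring.
      by rewrite ler_wpM2r ?sqr_ge0// ler_pM2l.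
    have h2 : 0 <= 2 * (y * (y - n)) ^+ 2 by rewrite mulr_ge0// sqr_ge0.
    have h3 : 0 <= n ^+ 2 * y ^+ 2 by rewrite mulr_ge0// sqr_ge0.
    nra.
  have -> : 8 * E (fun x : Y m => A l.+1 x * N l.+1 x ^+ 2) =
      8 * E (fun z : Y m.+1 => (q z + A l z) * q z) +
      8 * (E (fun z : Y m.+1 => q z * N l z ^+ 2) +
           E (fun z : Y m.+1 => A l z * N l z ^+ 2)).
    rewrite AN mulrDr; congr (_ + _ * _).
    rewrite -expectD; [|hoelder_side..]; congr (E _); apply/funext=> z; ring.
  have := IH m.+1; lra.
pose K := 6 * B ^+ 2 + 64 * (1 + K2 + B ^+ 2).
have BB := sqr_ge0 B; have KK := K20.
exists K => [|l m]; first by rewrite /K; lra.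
have h1 := H l m; have h2 := EA2 l m; have w0 := W0 l m; have aa := a0 l m.
have h3 : 8 * E (fun x : Y m => A l x * N l x ^+ 2) <=
    32 * E (fun x : Y m => A l x ^+ 2) + 2^-1 * E (fun x : Y m => N l x ^+ 4).
  rewrite -!expectZ; [|hoelder_side..]; rewrite -!expectD; [|hoelder_side..].
  apply: expect_le; [hoelder_side|hoelder_side|] => x.
  have := sqr_ge0 (8 * A l x - N l x ^+ 2); nra.
have h4 : E (fun x : Y m => N l x ^+ 4) <=
   6 * B ^+ 2 * psum e l m + 64 * (psum e l m ^+ 2 + (K2 + B ^+ 2) * psum e l m).
  have : 0 <= K2 * dsum d e l m by exact: mulr_ge0.
  lra.
rewrite -/(N l); apply: le_trans h4 _; rewrite /K.
have a2 := sqr_ge0 (psum e l m).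
have t1 := mulr_ge0 BB a2; have t2 := mulr_ge0 KK a2.
lra.
Qed.

End moments.

(** * Tight sums have bounded variance *)

Section cutoff.
Context (R : realType) (C : R).
Hypothesis C0 : 0 < C.

(** A Lipschitz substitute for the indicator of |t| > C: it vanishes for |t| <= C and equals 1 for
    |t| >= 2 C. *)
Definition cutoff (t : R) : R := Num.min 1 (Num.max 0 (`|t| / C - 1)).

Lemma cutoff_ge0 t : 0 <= cutoff t.
Proof. by rewrite /cutoff le_min ler01 le_max lexx. Qed.

Lemma cutoff_le1 t : cutoff t <= 1.
Proof. by rewrite /cutoff ge_min lexx. Qed.

Lemma cutoff_eq0 t : `|t| <= C -> cutoff t = 0.
Proof.
move=> tC; rewrite /cutoff (_ : Num.max _ _ = 0); first by rewrite minEle ler10.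
by apply/max_idPl; rewrite subr_le0 ler_pdivrMr// mul1r.
Qed.

Lemma cutoff_eq1 t : 2 * C <= `|t| -> cutoff t = 1.
Proof.
move=> tC; apply/min_idPl; rewrite le_max; apply/orP; right.
by rewrite lerBrDr ler_pdivlMr.
Qed.

Lemma cutoff_lipschitz s t : `|cutoff s - cutoff t| <= C^-1 * `|s - t|.
Proof.
have H : `|(`|s| / C - 1) - (`|t| / C - 1)| <= C^-1 * `|s - t|.
  have -> : (`|s| / C - 1) - (`|t| / C - 1) = C^-1 * (`|s| - `|t|) by ring.
  rewrite normrM ger0_norm ?invr_ge0 ?(ltW C0)// ler_pM2l ?invr_gt0//.
  exact: ler_dist_dist.
apply: le_trans H; rewrite /cutoff.
move: (`|s| / C - 1) (`|t| / C - 1) => u v.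
have minL (a b : R) : `|Num.min 1 a - Num.min 1 b| <= `|a - b|.
  have := ler_norm (a - b); have := ler_norm (b - a); rewrite (distrC b a).
  by rewrite ler_norml; case: (leP 1 a); case: (leP 1 b); lra.
have maxL (a b : R) : `|Num.max 0 a - Num.max 0 b| <= `|a - b|.
  have := ler_norm (a - b); have := ler_norm (b - a); rewrite (distrC b a).
  by rewrite ler_norml; case: (leP 0 a); case: (leP 0 b); lra.
exact: le_trans (minL _ _) (maxL _ _).
Qed.

End cutoff.

Section tight_sums.
Context (R : realType) (beta : R) (Y : nat -> pmetricType R).
Context (T : forall n, Y n -> Y n.+1) (S : mixing_system beta T).
Local Notation E := (expect S).
Local Notation P := (dual S).

(** Tightness, under the equivariant measure at time m, of the sums started at time m. *)
Definition tight_from (m : nat) (F : forall n, Y n -> R) :=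
  forall eps : R, 0 < eps -> exists2 C : R, 0 < C &
    forall l, E (fun x : Y m => cutoff C (bsum T l F x)) <= eps.

Lemma hoelder_cutoff n C (g : Y n -> R) : 0 < C -> hoelder_fun beta g ->
  hoelder_fun beta (fun x => cutoff C (g x)).
Proof.
move=> C0 [c hg]; exists (1 + C^-1 * c).
apply: (hoelder_le_lipschitz (u := cutoff C) _ _ _ hg).
- by rewrite invr_ge0 ltW.
- by move=> t; rewrite ger0_norm ?cutoff_ge0// cutoff_le1.
- exact: cutoff_lipschitz.
Qed.

Lemma expect_bsum_martingale (D : forall n, Y n -> R) l m :
  (forall n, hoelder_fun beta (D n)) -> (forall n x, P (D n) x = 0) ->
  E (fun x : Y m => bsum T l D x) = 0.
Proof.
move=> hD PD; elim: l m => [|l IH] m /=; first exact: (expect0 S).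
have hN := hoelder_bsum S l m.+1 hD.
rewrite expectD//; last exact: (hoelder_pull S hN).
rewrite (expect_pull S hN) IH addr0 -(expect_dual S)//.
rewrite (_ : P (D m) = fun=> 0) ?expect0//; apply/funext=> z; exact: PD.
Qed.

(** Let s be the variance of the martingale part and a the sum of the means. The coboundary is
    bounded, so the sum of F is a + N up to 2 C; tightness then bounds s and a together. *)
Lemma tight_decomposition (F : forall n, Y n -> R) B m :
  (forall n, hoelder_le beta B (F n)) -> tight_from m F ->
  exists C (D v : forall n, Y n -> R) V,
  [/\ forall n, hoelder_le beta C (D n) /\ hoelder_le beta C (v n),
      forall n x, P (D n) x = 0,
      forall n x, F n x = E (F n) + D n x + (v n.+1 (T x) - v n x),
      forall l, psum (fun n => E (fun x => D n x ^+ 2)) l m <= V &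
      forall l, E (fun x : Y m => bsum T l F x ^+ 2) <= V].
Proof.
move=> hF tF; have [C [D [v [hD hv PD FE]]]] := martingale_decomposition S hF.
have [K K0 N4] := fourth_moment_bsum hD PD.
have C0 : 0 <= C by exact: hoelder_le_ge0 (hD 0).
pose K1 := K + 1; have K1_gt0 : 0 < K1 by rewrite /K1; lra.
(* This level is below 1/4, which absorbs the a^2 term in [main], and small enough to make the
   cutoff term in [WE] at most s/16. *)
have eps0 : 0 < (64 * K1)^-1 by rewrite invr_gt0 mulr_gt0.
have [c c0 tc] := tF _ eps0.
have hD' n : hoelder_fun beta (D n) by exists C.
have hF' n : hoelder_fun beta (F n) by exists B.
(* A bound for |a + N| wherever the sum of F is below 2 c in absolute value. *)
pose C2 := 2 * c + 2 * C.
pose s l := psum (fun n => E (fun x => D n x ^+ 2)) l m.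
pose a l := \sum_(i < l) E (F (i + m)%N).
have FN l (x : Y m) : `|bsum T l F x - (a l + bsum T l D x)| <= 2 * C.
  rewrite (eq_bsum _ _ _ (fun n x _ => FE n x)) bsumD bsumD bsum_cst.
  have [vl [vlC ->]] := bsum_coboundary T l m v.
  have vC n y : `|v n y| <= C by case: (hv n).
  rewrite (_ : _ - _ = vl x - v m x); last by rewrite /a; ring.
  apply: le_trans (ler_normB _ _) _.
  have := vC m x; have := vlC _ vC x; lra.
have S_ge0 l : 0 <= s l.
  by rewrite /s -(second_moment_bsum hD PD); apply: (expect_ge0 S) => [|x];
    [apply: hoelderX; exact: (hoelder_bsum S) | exact: sqr_ge0].
pose W l := E (fun x : Y m => cutoff c (bsum T l F x) * bsum T l D x ^+ 2).
(* Where the cutoff is not 1 the sum a + N stays bounded; the remaining part of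
   E N^2 is small by the fourth moment bound. *)
have main l : s l + a l ^+ 2 / 2 <= C2 ^+ 2 + 2 * W l.
  have hN := hoelder_bsum S l m hD'; have hS := hoelder_bsum S l m hF'.
  have hc := hoelder_cutoff c0 hS.
  have EN : E (fun x : Y m => bsum T l D x ^+ 2) = s l.
    exact: second_moment_bsum hD PD l m.
  have EN1 := expect_bsum_martingale l m hD' PD.
  have hN2 := hoelderX 2 hN.
  have hcN := hoelderM hc hN2.
  have : E (fun x : Y m => bsum T l D x ^+ 2 + (2 * a l * bsum T l D x + a l ^+ 2))
    <= E (fun x : Y m => 2 * (cutoff c (bsum T l F x) * bsum T l D x ^+ 2) +
          (2 * a l ^+ 2 * cutoff c (bsum T l F x) + C2 ^+ 2)).
    apply: expect_le.
    - apply: hoelderD => //; apply: hoelderD; last exact: hoelder_const.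
      exact: hoelderZ.
    - apply: hoelderD; first exact: hoelderZ.
      by apply: hoelderD; [exact: hoelderZ | exact: hoelder_const].
    - move=> x; have := FN l x.
      set u := bsum T l F x; set t := bsum T l D x.
      have [cu|uc] := leP (2 * c) `|u|.
        rewrite (cutoff_eq1 c0 cu) => _.
        by have := sqr_ge0 (t - a l); have := sqr_ge0 C2; lra.
      have k0 := cutoff_ge0 c u; set k := cutoff c u in k0 *.
      rewrite ler_norml => /andP[f1 f2]; move: uc; rewrite ltr_norml => /andP[u1 u2].
      have : (a l + t) ^+ 2 <= C2 ^+ 2.
        rewrite -[leLHS]real_normK ?num_real// ler_sqr ?nnegrE//.
          by rewrite ler_norml /C2; apply/andP; split; lra.
        by rewrite /C2; lra.
      have := mulr_ge0 k0 (sqr_ge0 t); have := mulr_ge0 k0 (sqr_ge0 (a l)).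
      lra.
  rewrite !expectD; try exact: hoelderZ; try exact: hoelder_const; try by [];
    try by apply: hoelderD; [exact: hoelderZ|exact: hoelder_const].
  rewrite !expect_cst !expectZ// EN EN1 mulr0 add0r -/(W l).
  have := tc l; set k := E (fun x => cutoff c _) => kc.
  have k4 : 2 * a l ^+ 2 * k <= a l ^+ 2 / 2.
    have -> : a l ^+ 2 / 2 = 2 * a l ^+ 2 * 4^-1 by field.
    apply: ler_wpM2l; first by rewrite mulr_ge0// sqr_ge0.
    apply: le_trans kc _.
    by rewrite lef_pV2 ?posrE ?mulr_gt0// /K1; lra.
  lra.
(* For s > 1 the fourth moment is at most 2 K1 s^2. Young's inequality k t^2 <= eta t^4 + k / (4
   eta), for 0 <= k <= 1, with the [eta] below gives W <= s/8 + s/16, so W can be absorbed into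
   s. *)
have WE l : s l <= 1 \/ 2 * W l <= 3 / 8 * s l.
  have [s1|s1] := leP (s l) 1; [by left | right].
  have hN := hoelder_bsum S l m hD'; have hS := hoelder_bsum S l m hF'.
  have hc := hoelder_cutoff c0 hS.
  have s0 : 0 < s l by lra.
  pose eta := (16 * K1 * s l)^-1.
  have eta0 : 0 < eta by rewrite invr_gt0 !mulr_gt0.
  have etaE : eta * (16 * K1 * s l) = 1 by rewrite /eta mulVf// !mulf_neq0// gt_eqF.
  have : W l <= eta * E (fun x : Y m => bsum T l D x ^+ 4) +
      (4 * eta)^-1 * E (fun x : Y m => cutoff c (bsum T l F x)).
    have hN4 := hoelderX 4 hN.
    rewrite -!expectZ// -expectD; try exact: hoelderZ.
    apply: expect_le.
    - by apply: hoelderM => //; exact: hoelderX.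
    - by apply: hoelderD; exact: hoelderZ.
    - move=> x; have k0 := cutoff_ge0 c (bsum T l F x).
      have k1 := cutoff_le1 c (bsum T l F x).
      set k := cutoff c _ in k0 k1 *; set t := bsum T l D x.
      have e4 : 4 * eta * (4 * eta)^-1 = 1 by rewrite mulfV// mulf_neq0// gt_eqF.
      rewrite -(@ler_pM2l _ (4 * eta)) ?mulr_gt0//.
      rewrite mulrDr [X in _ <= _ + X]mulrA e4 mul1r.
      have := sqr_ge0 (2 * eta * t ^+ 2 - k).
      have : k ^+ 2 <= k by rewrite expr2 ler_piMl.
      lra.
  have n4 := N4 l m; rewrite -/(s l) in n4.
  have n4' : eta * E (fun x : Y m => bsum T l D x ^+ 4) <= s l / 8.
    apply: (@le_trans _ _ (eta * (K * (s l ^+ 2 + s l)))); first by rewrite ler_pM2l.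
    apply: (@le_trans _ _ (eta * (K1 * (2 * s l * s l)))).
      rewrite ler_pM2l//; apply: ler_pM => //; rewrite ?addr_ge0 ?sqr_ge0//.
        by rewrite /K1; lra.
      have : s l * 1 <= s l * s l by rewrite ler_pM2l// ltW.
      lra.
    have -> : eta * (K1 * (2 * s l * s l)) = eta * (16 * K1 * s l) * (s l / 8).
      by field.
    by rewrite etaE mul1r.
  have k4' : (4 * eta)^-1 * E (fun x : Y m => cutoff c (bsum T l F x)) <= s l / 16.
    apply: (@le_trans _ _ ((4 * eta)^-1 * (64 * K1)^-1)).
      by rewrite ler_pM2l ?invr_gt0 ?mulr_gt0.
    have -> : (4 * eta)^-1 = 4 * K1 * s l.
      by rewrite /eta invfM invrK; field.
    have -> : 4 * K1 * s l / (64 * K1) = s l / 16 by field; rewrite gt_eqF.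
    by [].
  lra.
have W1 l : s l <= 1 -> W l <= 1.
  move=> s1; apply: le_trans s1; rewrite /s -(second_moment_bsum hD PD).
  have hN := hoelder_bsum S l m hD'; have hS := hoelder_bsum S l m hF'.
  have hc := hoelder_cutoff c0 hS.
  apply: expect_le; [by apply: hoelderM => //; exact: hoelderX|exact: hoelderX|].
  by move=> x; rewrite ler_piMl ?sqr_ge0// cutoff_le1.
have sa l : s l <= 2 * C2 ^+ 2 + 1 /\ a l ^+ 2 <= 2 * C2 ^+ 2 + 4.
  have := main l; have := sqr_ge0 (a l); have := sqr_ge0 C2; have := S_ge0 l.
  by case: (WE l) => [s1|]; [have := W1 l s1|]; split; lra.
pose V := 3 * (2 * C2 ^+ 2 + 1) + 3 * (2 * C2 ^+ 2 + 4) + 3 * (4 * C ^+ 2).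
exists C, D, v, V; split=> // l.
  by have [+ _] := sa l; rewrite -/(s l) /V; have := sqr_ge0 C2; have := sqr_ge0 C; lra.
have hN := hoelder_bsum S l m hD'; have hS := hoelder_bsum S l m hF'.
have : E (fun x : Y m => bsum T l F x ^+ 2) <=
    E (fun x : Y m => 3 * bsum T l D x ^+ 2 + (3 * a l ^+ 2 + 3 * (4 * C ^+ 2))).
  apply: expect_le; first exact: hoelderX.
    by apply: hoelderD; [apply: hoelderZ; exact: hoelderX | exact: hoelder_const].
  move=> x; have := FN l x; set u := bsum T l F x; set t := bsum T l D x => H.
  have : (u - (a l + t)) ^+ 2 <= (2 * C) ^+ 2.
    by rewrite -[leLHS]real_normK ?num_real// ler_sqr ?nnegrE// mulr_ge0.
  set g := u - _ => g2; have -> : u = g + a l + t by rewrite /g; ring.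
  have := sqr_ge0 (g - a l); have := sqr_ge0 (g - t); have := sqr_ge0 (a l - t).
  lra.
rewrite expectD; [|by apply: hoelderZ; exact: hoelderX|exact: hoelder_const].
rewrite expectZ ?expect_cst; last exact: hoelderX.
rewrite (second_moment_bsum hD PD) -/(s l).
have [] := sa l; rewrite /V; lra.
Qed.

End tight_sums.

(** * Geometric sequences and summable variances *)

Lemma exprn_small (R : realType) (a e : R) : 0 <= a < 1 -> 0 < e ->
  exists q, a ^+ q < e.
Proof.
move=> /andP[a0 a1] e0.
have /cvgrPdist_lt/(_ e e0) [N _ /(_ N (leqnn N))] : a ^+ n @[n --> \oo] --> 0.
  by apply: cvg_expr; rewrite ger0_norm.
by rewrite /= sub0r normrN ger0_norm ?exprn_ge0// => h; exists N.
Qed.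

Lemma psumD (R : realType) (e : nat -> R) k l m :
  psum e (k + l) m = psum e k m + psum e l (k + m).
Proof. by elim: k m => [|k IH] m /=; rewrite ?add0r// IH addrA addnS. Qed.

Lemma psum_ge0 (R : realType) (e : nat -> R) l m :
  (forall n, 0 <= e n) -> 0 <= psum e l m.
Proof. by move=> e0; elim: l m => //= l IH m; rewrite addr_ge0. Qed.

Lemma psum_bounded_small (R : realType) (e : nat -> R) m V eps :
  (forall n, 0 <= e n) -> (forall l, psum e l m <= V) -> 0 < eps ->
  exists2 N, (m <= N)%N & forall n, (N <= n)%N -> e n <= eps.
Proof.
move=> e0 eV eps0.
have psumE l : psum e l m = series (fun i => e (i + m)%N) l.
  rewrite /series /= big_mkord; elim: l (m) => [|l IH] k /=; first by rewrite big_ord0.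
  rewrite big_ord_recl IH; congr (_ + _).
  by apply: eq_bigr => i _; rewrite addnS.
have : cvgn (series (fun i => e (i + m)%N)).
  apply: nondecreasing_is_cvgn.
    apply/nondecreasing_seqP => l; rewrite -!psumE -(addn1 l) psumD lerDl.
    exact: psum_ge0.
  by exists V => _ [l _ <-]; rewrite -psumE.
move=> /cvg_series_cvg_0 /cvgrPdist_le /(_ eps eps0) [N _ NE].
exists (N + m)%N => [|n]; first exact: leq_addl.
move=> Nn; have := NE (n - m)%N; rewrite /= leq_subRL; last first.
  exact: leq_trans (leq_addl _ _) Nn.
rewrite addnC subnK; last exact: leq_trans (leq_addl _ _) Nn.
by rewrite sub0r normrN ger0_norm//; apply.
Qed.

(** * Shadowing *)

Section orbits.
Context (R : realType) (Y : nat -> pmetricType R).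
Context (T : forall n, Y n -> Y n.+1).

Definition is_orbit m (w : forall n, Y n) :=
  forall n, (m <= n)%N -> w n.+1 = T (w n).

Lemma orbit_from m (x : Y m) : exists2 w, is_orbit m w & w m = x.
Proof.
by have [w [wm wS]] := family_from T (fun n => point) x; exists w.
Qed.

Lemma orbit_inj m w w' : is_orbit m w -> is_orbit m w' -> w m = w' m ->
  forall n, (m <= n)%N -> w n = w' n.
Proof.
move=> ow ow' ww'; elim=> [|n IH]; first by rewrite leqn0 => /eqP m0; subst m.
rewrite leq_eqVlt => /orP[/eqP mn|mn]; first by subst m.
by rewrite ow// ow'// IH.
Qed.

Lemma is_orbitW m n w : (m <= n)%N -> is_orbit m w -> is_orbit n w.
Proof. by move=> mn ow k nk; apply: ow; exact: leq_trans nk. Qed.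

Context (xi gamma : R).
Hypothesis xi_itv : 0 < xi <= 1.
Hypothesis gamma_gt1 : 1 < gamma.
Hypothesis surjT : forall n (z : Y n.+1), exists y, T y = z.
Hypothesis pairT : forall n (x x' : Y n.+1) (y : Y n), mdist x x' <= xi ->
  T y = x -> exists2 y', T y' = x' & mdist y y' <= gamma^-1 * mdist x x'.

Lemma orbit_to q m n (x : Y n) : n = (q + m)%N ->
  exists2 w, is_orbit m w & w n = x.
Proof.
elim: q n x => [|q IH] n x e; first by subst n; exact: orbit_from.
subst n; have [y yx] := surjT x.
have [w ow wy] := IH _ y erefl; exists w => //.
by rewrite ow ?leq_addl// wy.
Qed.

(** The end point x is pulled back one step at a time along the inverse branch paired with w; each
    step contracts by 1/gamma, so the distance stays below xi and the pairing applies again. *)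
Lemma shadowing q m n (w : forall n, Y n) (x : Y n) : n = (q + m)%N ->
  is_orbit m w -> mdist (w n) x <= xi ->
  exists w', [/\ is_orbit m w', w' n = x & forall i, (m <= i <= n)%N ->
    mdist (w i) (w' i) <= gamma^-1 ^+ (n - i) * mdist (w n) x].
Proof.
have g0 : 0 < gamma^-1 by rewrite invr_gt0; apply: lt_trans gamma_gt1.
elim: q n x => [|q IH] n x e ow wx.
  subst n; have [w' ow' w'x] := orbit_from x; exists w'; split=> // i.
  move=> mi; have {mi} im : i = m by apply/eqP; rewrite eqn_leq andbC.
  by subst i; rewrite w'x subnn expr0 mul1r.
subst n; have wS := ow _ (leq_addl q m).
have [y yx dy] := pairT wx (esym wS).
have dxi : mdist (w (q + m)%N) y <= xi.
  apply: le_trans dy _; apply: le_trans wx.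
  by rewrite ler_piMl ?mdist_ge0// invf_le1 ?ltW// (lt_trans _ gamma_gt1).
have [w' [ow' w'y wi]] := IH _ y erefl ow dxi.
have w'x : w' (q.+1 + m)%N = x by rewrite ow' ?leq_addl// w'y.
exists w'; split=> // i /andP[mi]; rewrite leq_eqVlt => /orP[/eqP iq|iq].
  by subst i; rewrite subnn expr0 mul1r w'x.
rewrite ltnS in iq; have := wi i; rewrite mi iq => /(_ isT) /le_trans; apply.
have -> : (q.+1 + m - i = (q + m - i).+1)%N by rewrite addSn subSn.
rewrite exprSr -mulrA ler_wpM2l//.
by rewrite exprn_ge0// ltW.
Qed.

Context (n0 : nat).
Hypothesis coverT : forall m (p : Y m) n (z : Y n), n = (n0 + m)%N ->
  exists w, [/\ is_orbit m w, mdist p (w m) < xi & w n = z].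

(** Follow p for q steps, reach z from the xi-ball around its image by covering, and pull the chosen
    point of that ball back along the orbit of p: it lands within gamma^(-q) of p. The time k
    depends on rho only. *)
Lemma exactness rho : 0 < rho -> exists k, forall m (p : Y m) n (z : Y n),
  n = (k + m)%N -> exists w, [/\ is_orbit m w, mdist p (w m) < rho & w n = z].
Proof.
move=> rho0; have g0 : 0 < gamma^-1 by rewrite invr_gt0; apply: lt_trans gamma_gt1.
have g1 : gamma^-1 < 1 by rewrite invf_lt1// (lt_trans _ gamma_gt1).
have [|q qr] := @exprn_small _ gamma^-1 rho _ rho0; first by rewrite ltW.
exists (n0 + q)%N => m p n z e.
have [w ow wm] := orbit_from p.
have [w1 [ow1 w1d w1z]] := coverT (w (q + m)%N) z (etrans e (esym (addnA _ _ _))).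
have [w2 [ow2 w2e w2d]] := shadowing erefl ow (ltW w1d).
exists w2; split=> //.
  have := w2d m; rewrite leqnn leq_addl wm addnK => /(_ isT) /le_lt_trans; apply.
  apply: le_lt_trans qr; rewrite ler_piMr ?exprn_ge0 ?(ltW g0)//.
  by apply: (le_trans (ltW w1d)); case/andP: xi_itv.
rewrite -w1z; apply: (orbit_inj (m := (q + m)%N)) => //.
- by apply: is_orbitW ow2; exact: leq_addl.
- by rewrite e -addnA leq_addl.
Qed.

End orbits.

(** * Lower bounds from exactness *)

Section lower_bounds.
Context (R : realType) (beta : R) (Y : nat -> pmetricType R).
Context (T : forall n, Y n -> Y n.+1) (S : mixing_system beta T).
Local Notation E := (expect S).
Local Notation P := (dual S).
Hypothesis beta_gt0 : 0 < beta.
Hypothesis exactT : forall rho : R, 0 < rho ->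
  exists k, forall m (p : Y m) n (z : Y n), n = (k + m)%N ->
  exists w, [/\ is_orbit T m w, mdist p (w m) < rho & w n = z].

(** Of all backward branches only the one along w is kept; each step costs a factor [weight_inf]. *)
Lemma dual_family_ge m (G : forall n, Y n -> R) w :
  (forall n, (m <= n)%N -> G n.+1 = P (G n)) -> (forall x, 0 <= G m x) ->
  is_orbit T m w -> forall n, (m <= n)%N ->
  (forall x, 0 <= G n x) /\ weight_inf S ^+ (n - m) * G m (w m) <= G n (w n).
Proof.
move=> GS G0 ow; elim=> [|n IH]; first by rewrite leqn0 => /eqP m0; subst m; rewrite mul1r.
rewrite leq_eqVlt => /orP[/eqP mn|mn]; first by subst m; rewrite subnn mul1r.
have [Gn Gw] := IH mn; rewrite GS// ow//; split=> [x|]; first exact: dual_ge0.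
apply: le_trans (dual_ge S _ Gn); rewrite subSn// exprS -mulrA.
by rewrite ler_pM2l// weight_inf_gt0.
Qed.

Lemma hoelder_family m (G : forall n, Y n -> R) :
  (forall n, (m <= n)%N -> G n.+1 = P (G n)) -> hoelder_fun beta (G m) ->
  forall n, (m <= n)%N -> hoelder_fun beta (G n) /\ E (G n) = E (G m).
Proof.
move=> GS hG; elim=> [|n IH]; first by rewrite leqn0 => /eqP m0; subst m.
rewrite leq_eqVlt => /orP[/eqP mn|mn]; first by subst m.
have [hn En] := IH mn; rewrite GS//; split; first exact: hoelder_dual.
by rewrite expect_dual.
Qed.

(** The dual operators preserve expectations, and after k steps every point has a preimage in the
    ball, so the image of g is at least [weight_inf]^k b everywhere. This bounds the masses of
    rho-balls below, uniformly in time. *)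
Lemma expect_ball_ge rho : 0 < rho -> exists2 c, 0 < c &
  forall m (p : Y m) (g : Y m -> R) b, hoelder_fun beta g ->
  (forall x, 0 <= g x) -> (forall x, mdist p x < rho -> b <= g x) ->
  c * b <= E g.
Proof.
move=> rho0; have [k exk] := exactT rho0.
have w0 := weight_inf_gt0 S.
exists (weight_inf S ^+ k) => [|m p g b hg g0 gb]; first exact: exprn_gt0.
have [G [Gm GS]] := dual_family S g.
have G0 x : 0 <= G m x by rewrite Gm.
have hGm : hoelder_fun beta (G m) by rewrite Gm.
have [hG EG] := hoelder_family GS hGm (leq_addl k m).
rewrite -[in leRHS]Gm -EG -(expect_cst S (k + m)%N (_ * b)).
apply: expect_le => //; first exact: hoelder_const.
move=> z; have [w [ow pw <-]] := exk m p _ z erefl.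
have [_] := dual_family_ge GS G0 ow (leq_addl k m); rewrite addnK; apply: le_trans.
by rewrite Gm ler_pM2l ?exprn_gt0// gb.
Qed.

Lemma sup_vanishes (D : forall n, Y n -> R) C m V eta :
  (forall n, hoelder_le beta C (D n)) ->
  (forall l, psum (fun n => E (fun x => D n x ^+ 2)) l m <= V) -> 0 < eta ->
  exists2 N, (m <= N)%N & forall n, (N <= n)%N -> forall x, `|D n x| <= eta.
Proof.
move=> hD DV eta0; have C0 : 0 <= C by exact: hoelder_le_ge0 (hD 0).
have hD' n : hoelder_fun beta (D n) by exists C.
have eta2 : 0 < eta / 2 by rewrite divr_gt0.
have [rho rho0 Drho] := hoelder_modulus beta_gt0 C0 eta2.
have [c c0 Ec] := expect_ball_ge rho0.
have e0 n : 0 <= E (fun x => D n x ^+ 2).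
  by apply: (expect_ge0 S) => [|x]; [exact: hoelderX | exact: sqr_ge0].
(* If |D| exceeds eta at one point, it is at least eta/2 on a rho-ball, and E D^2 is at least twice
   this value. *)
have eps0 : 0 < c * (eta ^+ 2 / 8) by rewrite mulr_gt0// divr_gt0// exprn_gt0.
have [N mN NE] := psum_bounded_small e0 DV eps0.
exists N => // n Nn x; rewrite leNgt; apply/negP => Dx.
have : c * (eta ^+ 2 / 4) <= E (fun x => D n x ^+ 2).
  apply: (Ec _ x) => [|y|y xy]; [exact: hoelderX | exact: sqr_ge0 |].
  have : `|D n x - D n y| <= eta / 2 by apply: ltW; exact: Drho (hD n) xy.
  have := ler_normD (D n x - D n y) (D n y); rewrite subrK => h1 h2.
  have h3 : eta / 2 <= `|D n y| by lra.
  have -> : eta ^+ 2 / 4 = (eta / 2) ^+ 2 by field.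
  rewrite -[leRHS]real_normK ?num_real//.
  by rewrite ler_sqr ?nnegrE// ltW.
have := NE n Nn; have : 0 < c * eta ^+ 2 by rewrite mulr_gt0// exprn_gt0.
lra.
Qed.

Lemma expect_orbit k (u : Y k -> R) (G : forall n, Y n -> R) :
  (forall n, G n.+1 = P (G n)) -> hoelder_fun beta (G 0%N) ->
  hoelder_fun beta u ->
  E (fun x => u (orbit_at T k x) * G 0%N x) = E (fun z => u z * G k z).
Proof.
move=> GS hG; elim: k u => [//|k IH] u hu /=.
have hGk : hoelder_fun beta (G k).
  by have [] := @hoelder_family 0 G (fun n _ => GS n) hG k (leq0n k).
by rewrite (IH (fun z => u (T z))) ?(expect_pullM S hu hGk) -?GS//; exact: (hoelder_pull S).
Qed.

Lemma expect_orbit1 k (u : Y k -> R) : hoelder_fun beta u ->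
  E (fun x => u (orbit_at T k x)) = E u.
Proof.
elim: k u => [//|k IH] u hu /=.
by rewrite (IH (fun z => u (T z))) ?(expect_pull S hu)//; exact: (hoelder_pull S).
Qed.

Lemma hoelder_orbit k (u : Y k -> R) : hoelder_fun beta u ->
  hoelder_fun beta (fun x => u (orbit_at T k x)).
Proof.
by elim: k u => [//|k IH] u hu /=; apply: (IH (fun z => u (T z))); exact: (hoelder_pull S).
Qed.

(* By exactness the image under T_0^k of a measure bounded below on one ball has
   a density bounded below everywhere. *)
Lemma tight_from_orbit rho (p : Y 0) (g : Y 0 -> R) b : 0 < rho -> 0 < b ->
  hoelder_fun beta g -> (forall x, 0 <= g x) ->
  (forall x, mdist p x < rho -> b <= g x) ->
  exists k, forall F : forall n, Y n -> R, (forall n, hoelder_fun beta (F n)) ->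
  (forall eps : R, 0 < eps -> exists2 C : R, 0 < C & forall l,
    E (fun x => cutoff C (bsum T l F (orbit_at T k x)) * g x) <= eps) ->
  tight_from S k F.
Proof.
move=> rho0 b0 hg g0 gb; have [k exk] := exactT rho0.
have w0 := weight_inf_gt0 S; exists k => F hF tF eps eps0.
pose c := weight_inf S ^+ k * b.
have c0 : 0 < c by rewrite mulr_gt0// exprn_gt0.
have [C C0 CE] := tF (c * eps) (mulr_gt0 c0 eps0).
exists C => // l; rewrite -(ler_pM2l c0); apply: le_trans (CE l).
have [G [Gm GS]] := dual_family S g.
have hGm : hoelder_fun beta (G 0%N) by rewrite Gm.
have hbs := hoelder_bsum S l k hF.
have hc := hoelder_cutoff C0 hbs.
rewrite -Gm (expect_orbit (u := fun z => cutoff C (bsum T l F z)))//; last first.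
  by move=> n; exact: GS.
rewrite -expectZ//; apply: expect_le; [exact: hoelderZ| |].
  by apply: hoelderM => //; have [] := hoelder_family GS hGm (leq0n k).
move=> z; rewrite mulrC ler_wpM2l ?cutoff_ge0//.
have [w [ow pw <-]] := exk _ p _ z (esym (addn0 k)).
have G0 x : 0 <= G 0%N x by rewrite Gm.
have [_] := dual_family_ge GS G0 ow (leq0n k); rewrite subn0; apply: le_trans.
by rewrite /c ler_pM2l ?exprn_gt0// Gm gb.
Qed.

End lower_bounds.

(** * Bounded spans *)

Section large_spans.
Context (R : realType) (beta : R) (Y : nat -> pmetricType R).
Context (T : forall n, Y n -> Y n.+1) (S : mixing_system beta T).
Local Notation E := (expect S).
Local Notation P := (dual S).
Hypothesis beta_gt0 : 0 < beta.
Context (xi gamma : R).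
Hypothesis xi_itv : 0 < xi <= 1.
Hypothesis gamma_gt1 : 1 < gamma.
Hypothesis surjT : forall n (z : Y n.+1), exists y, T y = z.
Hypothesis pairT : forall n (x x' : Y n.+1) (y : Y n), mdist x x' <= xi ->
  T y = x -> exists2 y', T y' = x' & mdist y y' <= gamma^-1 * mdist x x'.
Context (n0 : nat).
Hypothesis coverT : forall m (p : Y m) n (z : Y n), n = (n0 + m)%N ->
  exists w, [/\ is_orbit T m w, mdist p (w m) < xi & w n = z].

(** Subtracting the equation for f along two orbits cancels the constants. Modulo r, the difference
    of v thus changes at each step only by the differences of f and D. *)
Lemma drift (f D v : forall n, Y n -> R) (Z : forall n, Y n -> int)
    (c : nat -> R) (r eta A : R) m w w' (k : int) :
  (forall n x, f n x = c n + D n x + (v n.+1 (T x) - v n x) + r * (Z n x)%:~R) ->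
  (forall n x, (m <= n)%N -> `|D n x| <= eta) ->
  is_orbit T m w -> is_orbit T m w' ->
  `|v m (w m) - v m (w' m) - r * k%:~R| <= A ->
  forall q, exists k : int,
    `|v (q + m)%N (w (q + m)%N) - v (q + m)%N (w' (q + m)%N) - r * k%:~R| <=
    A + \sum_(i < q) (`|f (i + m)%N (w (i + m)%N) - f (i + m)%N (w' (i + m)%N)|
                      + 2 * eta).
Proof.
move=> fE Deta ow ow' vA; elim=> [|q [k' IH]]; first by exists k; rewrite big_ord0 addr0.
rewrite big_ord_recr /=.
have mq := leq_addl q m.
have -> : w (q.+1 + m)%N = T (w (q + m)%N) by rewrite ow.
have -> : w' (q.+1 + m)%N = T (w' (q + m)%N) by rewrite ow'.
move: (w (q + m)%N) (w' (q + m)%N) IH (Deta (q + m)%N) => y y' IH Dq.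
have h1 := Dq y mq; have h2 := Dq y' mq; move: (fE _ y) (fE _ y').
set a := f _ y; set a' := f _ y' => aE aE'.
exists (k' - Z _ y + Z _ y').
set V := v _ (T y); set V' := v _ (T y').
have -> : V - V' - r * (k' - Z _ y + Z _ y')%:~R =
    (v _ y - v _ y' - r * k'%:~R) + ((a - a') + - (D _ y - D _ y')).
  by rewrite aE aE' -/V -/V' rmorphD rmorphB /=; ring.
rewrite [leRHS]addrA; apply: le_trans (ler_normD _ _) _; apply: lerD => //.
apply: le_trans (ler_normD _ _) _; rewrite lerD2l normrN.
by apply: le_trans (ler_normB _ _) _; lra.
Qed.

(** The constants [C1], [C2], [C3], and with them the threshold for r, involve only f, beta, gamma
    and n0. Everything that depends on H enters through q, eta and n1, chosen afterwards. *)
Lemma span_bound (f : forall n, Y n -> R) Bf :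
  (forall n, hoelder_le beta Bf (f n)) ->
  exists2 r0 : R, 0 < r0 & forall r, r0 < r ->
  forall (H : forall n, Y n -> R) (Z : forall n, Y n -> int) (c : nat -> R) BH k,
  (forall n, hoelder_le beta BH (H n)) ->
  (forall n x, f n x = c n + H n x + r * (Z n x)%:~R) ->
  tight_from S k H ->
  exists n3 V (b : nat -> R), forall l,
    E (fun x : Y n3 => (bsum T l f x - b l) ^+ 2) <= V.
Proof.
move=> hf; have Bf0 : 0 <= Bf by exact: hoelder_le_ge0 (hf 0).
have fB n x : `|f n x| <= Bf by have [] := hf n.
have g0 : 0 < gamma by apply: lt_trans gamma_gt1.
pose th := gamma^-1 `^ beta.
have th0 : 0 < th by rewrite powR_gt0// invr_gt0.
have th1 : th < 1.
  have -> : 1 = (1 : R) `^ beta by rewrite powR1.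
  by rewrite gt0_ltr_powR// ?nnegrE ?invr_ge0 ?(ltW g0)// invf_lt1.
have thX i d : 0 <= d <= 1 -> (gamma^-1 ^+ i * d) `^ beta <= th ^+ i.
  move=> /andP[d0 d1].
  have -> : th ^+ i = (gamma^-1 ^+ i) `^ beta.
    elim: i => [|i IH]; first by rewrite !expr0 powR1.
    by rewrite !exprS IH powRM// ?exprn_ge0// invr_ge0 ltW.
  have gi : 0 <= gamma^-1 ^+ i by rewrite exprn_ge0// invr_ge0 ltW.
  rewrite ge0_ler_powR ?nnegrE ?mulr_ge0 ?(ltW beta_gt0)//.
  by rewrite ler_piMr.
(* Nearby points: 1 for the difference of v at the start of the backward orbits, 1 for the
   accumulated D, and a geometric series for f. *)
pose C1 := 2 + Bf / (1 - th).
have C10 : 0 <= C1 by rewrite addr_ge0// divr_ge0// subr_ge0 ltW.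
(* Arbitrary points: both come from one xi-ball, which costs 2 C1, after n0 steps estimated crudely
   with 2 eta <= 1. *)
pose C2 := 2 * C1 + n0%:R * (2 * Bf + 1).
(* A bound for |f - D - u o T + u|; two values of this function differ by at most 2 C3. *)
pose C3 := Bf + 1 + 2 * C2.
have C20 : 0 <= C2 by rewrite addr_ge0// ?mulr_ge0// addr_ge0// mulr_ge0.
exists (2 * C3) => [|r rC H Z c BH k hH fE tH]; first by rewrite /C3; lra.
have [C [D [v [V [hDv PD HE DV _]]]]] := tight_decomposition hH tH.
have hD n : hoelder_le beta C (D n) by have [] := hDv n.
have hv n : hoelder_le beta C (v n) by have [] := hDv n.
have C0 : 0 <= C by exact: hoelder_le_ge0 (hD 0).
pose c' n := c n + E (H n).
have fE' n x : f n x = c' n + D n x + (v n.+1 (T x) - v n x) + r * (Z n x)%:~R.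
  by rewrite fE HE /c'; ring.
have C1V : 0 < (C + 1)^-1 by rewrite invr_gt0 ltr_wpDl.
have [|q qC] := @exprn_small _ th (C + 1)^-1 _ C1V; first by rewrite ltW.
have {qC} Cq : C * th ^+ q <= 1.
  apply: (@le_trans _ _ ((C + 1) * (C + 1)^-1)); last by rewrite mulfV// gt_eqF// ltr_wpDl.
  by apply: ler_pM => //; rewrite ?exprn_ge0 ?(ltW th0) ?lerDl// ltW.
pose eta : R := (2 * q.+1%:R)^-1.
have eta0 : 0 < eta by rewrite invr_gt0 mulr_gt0.
have etaE : 2 * eta * q.+1%:R = 1 by rewrite /eta; field.
have eta2 : 2 * eta <= 1.
  by rewrite -[leRHS]etaE ler_peMr ?ler1n// mulr_ge0// ltW.
have exT := exactness xi_itv gamma_gt1 pairT coverT.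
have [n1 kn1 n1D] := sup_vanishes beta_gt0 exT hD DV eta0.
have claim1 m n (x x' : Y n) : (n1 <= m)%N -> n = (q + m)%N -> mdist x x' <= xi ->
    exists k : int, `|v n x - v n x' - r * k%:~R| <= C1.
  move=> n1m e xx'; have [w ow wx] := orbit_to surjT x e; subst x.
  have [w' [ow' w'x' ww']] := shadowing gamma_gt1 pairT e ow xx'; subst x'.
  have d01 : 0 <= mdist (w n) (w' n) <= 1.
    by rewrite mdist_ge0; apply: le_trans xx' _; case/andP: xi_itv.
  have dth i (mi : (m <= i <= n)%N) B (g : forall n, Y n -> R) :
      (forall n, hoelder_le beta B (g n)) -> `|g i (w i) - g i (w' i)| <= B * th ^+ (n - i).
    move=> hg; have B0 : 0 <= B by exact: hoelder_le_ge0 (hg 0).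
    have [_ /(_ (w i) (w' i)) /le_trans] := hg i; apply.
    rewrite ler_wpM2l//; apply: le_trans (thX (n - i)%N _ d01).
    rewrite ge0_ler_powR ?nnegrE ?mdist_ge0 ?mulr_ge0 ?exprn_ge0 ?invr_ge0 ?mdist_ge0//;
      rewrite ?(ltW g0) ?(ltW beta_gt0)//.
    exact: ww'.
  have vA : `|v m (w m) - v m (w' m) - r * (0 : int)%:~R| <= 1.
    rewrite mulr0 subr0; apply: le_trans Cq.
    have := dth m _ C v hv; rewrite e leqnn leq_addl addnK; exact.
  have Dm i x : (m <= i)%N -> `|D i x| <= eta.
    by move=> mi; apply: n1D; exact: leq_trans mi.
  have [k' k'P] := drift fE' Dm ow ow' vA q.
  subst n; exists k'; apply: le_trans k'P _.
  rewrite big_split /= sumr_const card_ord -[X in _ + (_ + X)]mulr_natr.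
  have : 2 * eta * q%:R <= 1.
    by rewrite -[leRHS]etaE ler_wpM2l ?ler_nat// mulr_ge0// ltW.
  suff : \sum_(i < q) `|f (i + m)%N (w (i + m)%N) - f (i + m)%N (w' (i + m)%N)|
      <= Bf / (1 - th) by rewrite /C1; lra.
  apply: (@le_trans _ _ (\sum_(i < q) Bf * th ^+ (q - i))).
    apply: ler_sum => i _.
    have := dth (i + m)%N _ Bf f hf; rewrite leq_addl leq_add2r (ltnW (ltn_ord i)).
    by rewrite subnDr; exact.
  rewrite -mulr_sumr ler_wpM2l//; apply: geometric_sum_le; by rewrite th0.
have claim2 m n (x x' : Y n) : (n1 <= m)%N -> n = (n0 + (q + m))%N ->
    exists k : int, `|v n x - v n x' - r * k%:~R| <= C2.
  move=> n1m e; pose p : Y (q + m)%N := point.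
  have [w [ow pw wx]] := coverT p x e; have [w' [ow' pw' w'x']] := coverT p x' e.
  subst x x'.
  have [k1 k1P] := claim1 _ _ _ _ n1m erefl (ltW pw).
  have [k2 k2P] := claim1 _ _ _ _ n1m erefl (ltW pw').
  have vA : `|v (q + m)%N (w (q + m)%N) - v (q + m)%N (w' (q + m)%N)
      - r * (k2 - k1)%:~R| <= 2 * C1.
    set a := v _ p in k1P k2P; move: k1P k2P.
    set b := v _ _; set b' := v _ _ => k1P k2P.
    have -> : b - b' - r * (k2 - k1)%:~R = (a - b' - r * k2%:~R) - (a - b - r * k1%:~R).
      by rewrite rmorphB /=; ring.
    by apply: le_trans (ler_normB _ _) _; lra.
  have Dm i x : (q + m <= i)%N -> `|D i x| <= eta.
    move=> mi; apply: n1D; apply: leq_trans mi.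
    by apply: leq_trans n1m _; exact: leq_addl.
  have [k' k'P] := drift fE' Dm ow ow' vA n0.
  subst n; exists k'; apply: le_trans k'P _; rewrite /C2 lerD2l.
  apply: (@le_trans _ _ (\sum_(i < n0) (2 * Bf + 1))); last first.
    by rewrite sumr_const card_ord -[leLHS]mulr_natr mulrC.
  apply: ler_sum => i _; apply: lerD => //.
  by apply: le_trans (ler_normB _ _) _; have := fB _ (w (i + (q + m))%N);
    have := fB _ (w' (i + (q + m))%N); lra.
pose n3 := (n0 + (q + n1))%N.
have claim3 n : exists kn : Y n -> int, forall x, (n3 <= n)%N ->
    `|v n x - v n point - r * (kn x)%:~R| <= C2.
  suff ex_k x : exists k : int, (n3 <= n)%N -> `|v n x - v n point - r * k%:~R| <= C2.
    by have [kn knP] := choice ex_k; exists kn.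
  have [n3n|] := boolP (n3 <= n)%N; last by exists 0.
  have n0q : (n0 + q <= n)%N by apply: leq_trans n3n; rewrite /n3 addnA leq_addr.
  have n13 : (n1 <= n - (n0 + q))%N by rewrite leq_subRL// -addnA.
  have [|k' k'P] := claim2 _ n x point n13; last by exists k'.
  by rewrite addnA subnKC.
pose kn n := sval (cid (claim3 n)).
have knP n x : (n3 <= n)%N -> `|v n x - v n point - r * (kn n x)%:~R| <= C2.
  exact: (svalP (cid (claim3 n))).
(* The real lift of v mod r, normalized at the base point. The integers [kn] are arbitrary choices,
   so nothing is known of u beyond its bound; it enters the final estimate only pointwise. *)
pose u n x := if (n3 <= n)%N then v n x - v n point - r * (kn n x)%:~R else 0.
have uC n x : `|u n x| <= C2.
  by rewrite /u; case: ifP => [/knP//|_]; rewrite normr0.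
pose b n := f n point - D n point - (u n.+1 (T point) - u n point).
have fb n x : (n3 <= n)%N -> f n x = (b n + D n x) + (u n.+1 (T x) - u n x).
  move=> n3n; pose J y := Z n y + kn n.+1 (T y) - kn n y.
  pose b' := c' n + (v n.+1 point - v n point).
  have fJ y : f n y - D n y - (u n.+1 (T y) - u n y) = b' + r * (J y)%:~R.
    rewrite fE' /u n3n (leq_trans n3n (leqnSn n)) /b' /J rmorphB rmorphD /=.
    by ring.
  (* Rigidity: r times an integer is at most 2 C3 < r in absolute value, so this integer is 0. *)
  have JJ : J x = J point.
    apply/eqP/negPn/negP => JJ.
    have : 1 <= `|(J x - J point)%:~R : R|.
      by rewrite -intr_norm -[1]/(1%:~R) ler_int -gtz0_ge1 normr_gt0 subr_eq0.
    have rJ : r * (J x - J point)%:~R =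
        (f n x - D n x - (u n.+1 (T x) - u n x)) -
        (f n point - D n point - (u n.+1 (T point) - u n point)).
      by rewrite !fJ rmorphB /=; ring.
    have r0 : 0 < r by apply: lt_trans rC; rewrite /C3; lra.
    have n1n : (n1 <= n)%N by apply: leq_trans n3n; rewrite /n3 addnA leq_addl.
    have aux y : `|f n y - D n y - (u n.+1 (T y) - u n y)| <= Bf + eta + 2 * C2.
      have := fB n y; have := n1D n n1n y; have := uC n.+1 (T y); have := uC n y.
      have := ler_normB (f n y - D n y) (u n.+1 (T y) - u n y).
      have := ler_normB (f n y) (D n y); have := ler_normB (u n.+1 (T y)) (u n y).
      lra.
    have : `|r * (J x - J point)%:~R| <= 2 * C3.
      rewrite rJ; apply: le_trans (ler_normB _ _) _.
      by have := aux x; have := aux point; rewrite /C3; lra.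
    rewrite normrM (gtr0_norm r0) => h1 h2.
    have : r * 1 <= r * `|(J x - J point)%:~R : R| by rewrite ler_pM2l.
    lra.
  have := fJ x; have := fJ point; rewrite JJ /b => <- h; rewrite -h; ring.
exists n3, (2 * V + 8 * C2 ^+ 2), (fun l => \sum_(i < l) b (i + n3)%N) => l.
have hD' n : hoelder_fun beta (D n) by exists C.
have hf' n : hoelder_fun beta (f n) by exists Bf.
have hN := hoelder_bsum S l n3 hD'; have hS := hoelder_bsum S l n3 hf'.
have second : E (fun x : Y n3 => bsum T l D x ^+ 2) <= V.
  rewrite (second_moment_bsum hD PD).
  have n3k : (k <= n3)%N by apply: leq_trans kn1 _; rewrite /n3 addnA leq_addl.
  (* The variance from n3 on is the tail of a sum of nonnegative terms started at k. *)
  have := DV ((n3 - k) + l)%N; rewrite psumD subnK//; apply: le_trans.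
  rewrite lerDr; apply: psum_ge0 => n.
  by apply: (expect_ge0 S) => [|x]; [exact: hoelderX | exact: sqr_ge0].
apply: (@le_trans _ _
    (E (fun x : Y n3 => 2 * bsum T l D x ^+ 2 + 8 * C2 ^+ 2))).
  apply: expect_le.
  - by apply: hoelderX; apply: hoelderD => //; exact: hoelder_const.
  - by apply: hoelderD; [apply: hoelderZ; exact: hoelderX | exact: hoelder_const].
  - move=> x; rewrite (eq_bsum _ _ _ fb) bsumD bsumD bsum_cst.
    have [vl [vlC ->]] := bsum_coboundary T l n3 u.
    have := vlC _ uC x; have := uC n3 x; set t := bsum T l D x.
    set y := vl x; set y' := u n3 x => h1 h2.
    have h3 : (y - y') ^+ 2 <= (2 * C2) ^+ 2.
      rewrite -[leLHS]real_normK ?num_real// ler_sqr ?nnegrE// ?mulr_ge0//.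
      by apply: le_trans (ler_normB _ _) _; lra.
    have -> : \sum_(i < l) b (i + n3)%N + t + (y - y') - \sum_(i < l) b (i + n3)%N
      = t + (y - y') by ring.
    have := sqr_ge0 (t - (y - y')); lra.
rewrite expectD ?expect_cst ?expectZ//; try exact: hoelderX; try exact: hoelder_const.
  by rewrite lerD2r ler_pM2l.
by apply: hoelderZ; exact: hoelderX.
Qed.

End large_spans.

(** * Integrals of Hoelder functions *)

Section hoelder_integrals.
Context (R : realType) (beta : R) (M : pmetricType R).
Implicit Types (C : R) (g : M -> R).

Lemma le_hoelder_norm C g : (hoelder_norm beta g <= C%:E)%E ->
  hoelder_le beta C g.
Proof.
rewrite /hoelder_norm.
set s1 := ereal_sup _; set s2 := ereal_sup _ => s12.
have g1 x : (`|g x|%:E <= s1)%E by apply: ereal_sup_ubound; exists x.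
have g2 x y : ((`|g x - g y| / mdist x y `^ beta)%:E <= s2)%E.
  by apply: ereal_sup_ubound; exists (x, y).
have s10 : (0 <= s1)%E by apply: le_trans (g1 point); rewrite lee_fin.
have s20 : (0 <= s2)%E.
  by apply: le_trans (g2 point point); rewrite lee_fin divr_ge0// powR_ge0.
split=> [x|x y].
  by rewrite -lee_fin; apply: le_trans (g1 x) _; apply: le_trans s12; exact: leeDl.
have : (`|g x - g y| / mdist x y `^ beta <= C).
  by rewrite -lee_fin; apply: le_trans (g2 x y) _; apply: le_trans s12; exact: leeDr.
have [->|xy] := eqVneq x y.
  rewrite subrr normr0 mul0r => C0; by rewrite mulr_ge0// powR_ge0.
by rewrite ler_pdivrMr// powR_gt0// mdist_gt0.
Qed.

Lemma hoelder_norm_le C g : hoelder_le beta C g ->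
  (hoelder_norm beta g <= (C + C)%:E)%E.
Proof.
move=> hg; have C0 := hoelder_le_ge0 hg; case: hg => [g1 g2].
rewrite EFinD; apply: leeD; apply: ge_ereal_sup => _ [x _ <-].
  by rewrite lee_fin.
rewrite lee_fin; have [->|d0] := eqVneq (mdist x.1 x.2 `^ beta) 0.
  by rewrite invr0 mulr0.
by rewrite ler_pdivrMr// lt_neqAle eq_sym d0 powR_ge0.
Qed.

Lemma hoelder_norm_ltyP g : (hoelder_norm beta g < +oo)%E <-> hoelder_fun beta g.
Proof.
split=> [g_fin|[C /hoelder_norm_le]]; last by move=> /le_lt_trans; apply; rewrite ltry.
exists (fine (hoelder_norm beta g)); apply: le_hoelder_norm.
rewrite fineK// ge0_fin_numE//; apply: adde_ge0; apply: le_ereal_sup_tmp.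
  by exists (`|g point|%:E); [exists point | rewrite lee_fin].
exists ((`|g point - g point| / mdist (point : M) (point : M) `^ beta)%:E).
  by exists (point, point).
by rewrite lee_fin divr_ge0// powR_ge0.
Qed.

Hypothesis beta_gt0 : 0 < beta.

Lemma hoelder_continuous g : hoelder_fun beta g -> continuous g.
Proof.
move=> [C hg] x; apply/cvgrPdist_lt => eps eps0.
have [rho rho0 grho] := hoelder_modulus beta_gt0 (hoelder_le_ge0 hg) eps0.
by apply/nbhs_ballP; exists rho => //= y; rewrite ballEmdist; exact: grho hg.
Qed.

Lemma measurable_ball_borel (x : M) (r : R) : measurable (ball x r : set (borel M)).
Proof.
apply: sub_sigma_algebra; rewrite openE => y; rewrite ballEmdist /= => xy.
apply/nbhs_ballP; exists (r - mdist x y) => /=; first by rewrite subr_gt0.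
move=> z; rewrite !ballEmdist /= ltrBrDl; apply: le_lt_trans.
exact: metric_triangle.
Qed.

Lemma hoelder_measurable g : hoelder_fun beta g ->
  measurable_fun setT (g : borel M -> R).
Proof.
move=> /hoelder_continuous /continuousP cg.
apply: (measurability _ (RGenOpens.measurableE R)).
move=> _ [_ [a [b ->] <-]]; rewrite setTI; apply: sub_sigma_algebra.
exact/cg/interval_open.
Qed.

Lemma hoelder_integrable (P : probability (borel M) R) g : hoelder_fun beta g ->
  P.-integrable setT (EFin \o (g : borel M -> R)).
Proof.
move=> hg; apply: measurable_bounded_integrable => //.
- by apply: (le_lt_trans (probability_le1 P measurableT)); rewrite ltry.
- exact: hoelder_measurable.
- case: hg => C [gC _]; exists C; split; first exact: num_real.
  by move=> r Cr x _ /=; apply: le_trans (gC x) (ltW Cr).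
Qed.

End hoelder_integrals.

Section probability_integrals.
Context (R : realType) (beta : R) (beta_gt0 : 0 < beta) (M : pmetricType R).
Context (P : probability (borel M) R).
Implicit Types (f g : M -> R).

Lemma hoelder_RintegralD f g : hoelder_fun beta f -> hoelder_fun beta g ->
  \int[P]_x (f x + g x) = \int[P]_x f x + \int[P]_x g x.
Proof. by move=> hf hg; apply: RintegralD => //; exact: (hoelder_integrable beta_gt0). Qed.

Lemma hoelder_RintegralZ a f : hoelder_fun beta f ->
  \int[P]_x (a * f x) = a * \int[P]_x f x.
Proof. by move=> hf; apply: RintegralZl => //; exact: (hoelder_integrable beta_gt0). Qed.

Lemma hoelder_le_Rintegral f g : hoelder_fun beta f -> hoelder_fun beta g ->
  (forall x, f x <= g x) -> \int[P]_x f x <= \int[P]_x g x.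
Proof.
by move=> hf hg fg; apply: le_Rintegral => //; exact: (hoelder_integrable beta_gt0).
Qed.

Lemma probability_Rintegral_cst (a : R) : \int[P]_(x in setT) a = a.
Proof.
have PT : P setT = 1%E by exact: probability_setT.
by rewrite Rintegral_cst// [X in fine X]PT mulr1.
Qed.

Lemma hoelder_EFin_Rintegral f : hoelder_fun beta f ->
  ((\int[P]_x f x)%:E = \int[P]_x (f x)%:E)%E.
Proof.
by move=> hf; rewrite /Rintegral fineK//; apply: integrable_fin_num => //;
  exact: (hoelder_integrable beta_gt0).
Qed.

End probability_integrals.

(** * The mixing system of the transfer operators *)

Section transfer_system.
Context (R : realType) (I : Type) (s : I -> I) (X : I -> pmetricType R).
Context (T : forall j, X j -> X (s j)) (phi h : forall j, X j -> R).
Context (nu : forall j, probability (borel (X j)) R) (lam : I -> R).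
Context (xi gamma beta : R) (o : I).
Hypothesis xi_itv : 0 < xi <= 1.
Hypothesis beta_gt0 : 0 < beta.
Hypothesis pairT : pairing T xi gamma.

Let Y n := X (iter n s o).
Let T' n : Y n -> Y n.+1 := @T (iter n s o).

Lemma fibre_finite j (x : X (s j)) : finite_set (@T j @^-1` [set x]).
Proof.
have [|k [y [_ [_ _ -> _ _]]]] := @pairT j x x.
  by rewrite mdistxx; case/andP: xi_itv => /ltW.
by apply: finite_image; exact: finite_finset.
Qed.

(** The pairing of x with itself indexes the fibre by ['I_k.+1], so it is not empty. *)
Lemma map_surj j (x : X (s j)) : exists y, T y = x.
Proof.
have [|k [y [_ [_ _ yE _ _]]]] := @pairT j x x.
  by rewrite mdistxx; case/andP: xi_itv => /ltW.
have : (@T j @^-1` [set x]) (y ord0) by rewrite yE; exists ord0.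
by exists (y ord0).
Qed.

Lemma map_pair j (x x' : X (s j)) (y : X j) : mdist x x' <= xi -> T y = x ->
  exists2 y', T y' = x' & mdist y y' <= gamma^-1 * mdist x x'.
Proof.
move=> xx' yx; have [k [z [z' [_ _ zE z'E zz']]]] := pairT xx'.
have : (@T j @^-1` [set x]) y by [].
rewrite zE => -[i _ <-]; exists (z' i) => //.
have : (range z') (z' i) by exists i.
by rewrite -z'E.
Qed.

Lemma transferPZ j a (f g : X j -> R) x :
  transfer T phi (fun y => a * f y + g y) x =
  a * transfer T phi f x + transfer T phi g x.
Proof.
rewrite /transfer mulr_fsumr -fsbig_split/=; last exact: fibre_finite.
by apply: eq_fsbigr => y _; ring.
Qed.

Lemma transferZ j a (f : X j -> R) x :
  transfer T phi (fun y => a * f y) x = a * transfer T phi f x.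
Proof. by rewrite /transfer mulr_fsumr; apply: eq_fsbigr => y _; ring. Qed.

Lemma transfer_pull j (u : X (s j) -> R) (g : X j -> R) x :
  transfer T phi (fun y => u (T y) * g y) x = u x * transfer T phi g x.
Proof.
rewrite /transfer mulr_fsumr; apply: eq_fsbigr => y; rewrite inE /= => ->.
by ring.
Qed.

Lemma transfer_ge0 j (g : X j -> R) x : (forall y, 0 <= g y) ->
  0 <= transfer T phi g x.
Proof. by move=> g0; apply: fsumr_ge0 => y _; rewrite mulr_ge0// expR_ge0. Qed.

Lemma transfer_ge j (g : X j -> R) y : (forall y, 0 <= g y) ->
  expR (phi y) * g y <= transfer T phi g (T y).
Proof.
move=> g0; rewrite /transfer (fsbigD1 y)//=; last exact: fibre_finite.
by rewrite lerDl; apply: fsumr_ge0 => z _; rewrite mulr_ge0// expR_ge0.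
Qed.

(** Proof irrelevance makes the equality of indices trivial, so this holds for every index type. *)
Lemma existT_inj j (z z' : X j) :
  existT (fun i => X i : Type) j z = existT (fun i => X i : Type) j z' -> z = z'.
Proof.
move=> e; have /= := projT2_eq e.
by rewrite (Prop_irrelevance (projT1_eq e) erefl).
Qed.

(* The indices iter k s (iter m s o) and iter (k + m) s o are equal but not
   convertible: packing points and functions with their index replaces casts. *)
Lemma map_iter_orbit m (w : forall n, Y n) k : is_orbit T' m w ->
  existT (fun i => X i : Type) (iter k s (iter m s o)) (map_iter T k (w m)) =
  existT (fun i => X i : Type) (iter (k + m) s o) (w (k + m)%N).
Proof.
move=> ow; elim: k => [//|k IH] /=; rewrite ow ?leq_addl//.
exact: (congr1 (fun p => existT (fun i => X i : Type) (s (projT1 p)) (T (projT2 p))) IH).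
Qed.

Lemma cover_orbit n0 : (forall j (x : X j), map_iter T n0 @` ball x xi = setT) ->
  forall m (p : Y m) n (z : Y n), n = (n0 + m)%N ->
  exists w, [/\ is_orbit T' m w, mdist p (w m) < xi & w n = z].
Proof.
move=> cov m p n z e; subst n.
have [z' z'z] : exists z' : X (iter n0 s (iter m s o)),
    existT (fun i => X i : Type) (iter n0 s (iter m s o)) z' =
    existT (fun i => X i : Type) (iter (n0 + m) s o) z.
  by rewrite /Y iterD in z *; exists z.
have : setT z' by []; rewrite -(cov _ p) => -[y]; rewrite ballEmdist /= => py yz'.
have [w ow wm] := orbit_from T' y; exists w; split=> //; first by rewrite wm.
by apply: existT_inj; rewrite -map_iter_orbit// wm yz'.
Qed.

Lemma transfer_iter_family m (G : forall n, Y n -> R) k :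
  (forall n, (m <= n)%N -> G n.+1 = transfer T phi (G n)) ->
  existT (fun i => X i -> R) (iter k s (iter m s o))
    (@transfer_iter R I s X T phi (iter m s o) k (G m)) =
  existT (fun i => X i -> R) (iter (k + m) s o) (G (k + m)%N).
Proof.
move=> GS; elim: k => [//|k IH] /=; rewrite GS ?leq_addl//.
exact: (congr1 (fun p => existT (fun i => X i -> R) (s (projT1 p))
                           (transfer T phi (projT2 p))) IH).
Qed.

Hypothesis lipT : uniformly_lipschitz T.
Hypothesis hphi : bounded_hoelder beta phi.
Hypothesis rpf : rpf_triplets T phi beta h nu lam.

Lemma eigenfunction_inf : exists2 a : R, 0 < a & forall j (x : X j), a <= h x.
Proof. by case: rpf. Qed.

Lemma eigenfunction_hoelder : exists C : R, forall j, hoelder_le beta C (@h j).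
Proof. by case: rpf => _ [[C hC] _]; exists C => j; exact: le_hoelder_norm. Qed.

(** Only |lam| is bounded by assumption; the sign comes from L h = lam h, where h and the weights
    are positive and fibres are nonempty. *)
Lemma eigenvalue_gt0 j : 0 < lam j.
Proof.
have [a a0 ha] := eigenfunction_inf; case: rpf => _ [_ [_ [_ [Lh _]]]].
have h0 i (x : X i) : 0 < h x by apply: lt_le_trans (ha _ x).
have [y yx] := map_surj (point : X (s j)).
rewrite -(pmulr_lgt0 _ (h0 _ (T y))) -Lh; apply: lt_le_trans (transfer_ge _ _).
  by rewrite mulr_gt0// expR_gt0.
by move=> z; exact: ltW.
Qed.

(** No estimate on inverse branches: the spectral gap with n = 1 bounds L g / lam - nu(g) h, and h
    is Hoelder. *)
Lemma hoelder_transfer j (g : X j -> R) : hoelder_fun beta g ->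
  hoelder_fun beta (transfer T phi g).
Proof.
move=> hg; have [Ch hh] := eigenfunction_hoelder.
case: rpf => _ [_ [_ [_ [_ [_ [C0 [d [C00 [d01 mixT]]]]]]]]].
have [C hC] := hg; have hn := hoelder_norm_le hC.
have g_fin := (hoelder_norm_ltyP beta g).2 hg.
have := mixT j 1%N g g_fin; rewrite big_ord1 /= => H.
have H1 : hoelder_fun beta (fun x => (lam j)^-1 * transfer T phi g x -
    (\int[nu j]_y g y) * h x).
  apply/hoelder_norm_ltyP; apply: le_lt_trans H _.
  rewrite lte_mul_pinfty// ?lee_fin ?mulr_ge0 ?exprn_ge0//; first exact: ltW.
  by case/andP: d01 => /ltW.
have H2 := hoelderZ (lam j) (hoelderD H1
  (hoelderZ (\int[nu j]_y g y) (ex_intro _ Ch (hh (s j))))).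
move: H2; congr hoelder_fun; apply/funext=> x.
by rewrite addrNK mulrA mulfV ?mul1r// gt_eqF// eigenvalue_gt0.
Qed.

Let invh : exists2 C, 0 < C & forall j, hoelder_le beta C (fun x => (@h j x)^-1).
Proof.
have [a a0 ha] := eigenfunction_inf; have [Ch hh] := eigenfunction_hoelder.
have Ch0 : 0 <= Ch by exact: hoelder_le_ge0 (hh o).
have C0 : 0 < a^-1 + Ch / a ^+ 2.
  by rewrite ltr_wpDr ?invr_gt0// divr_ge0// exprn_ge0// ltW.
have h0 j (x : X j) : 0 < h x by apply: lt_le_trans (ha _ x).
exists (a^-1 + Ch / a ^+ 2) => // j; split=> [x|x y].
  rewrite ger0_norm ?invr_ge0 ?(ltW (h0 _ x))//.
  apply: (@le_trans _ _ a^-1); first by rewrite lef_pV2 ?posrE.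
  by rewrite lerDl divr_ge0// exprn_ge0// ltW.
have -> : (h x)^-1 - (h y)^-1 = (h y - h x) * ((h x)^-1 * (h y)^-1).
  by field; rewrite !gt_eqF.
have [_ /(_ y x)] := hh j; rewrite metric_sym => hxy; rewrite normrM.
apply: (@le_trans _ _ ((Ch * mdist x y `^ beta) * (a^-1 * a^-1))).
  apply: ler_pM => //; rewrite normrM !ger0_norm ?invr_ge0 ?(ltW (h0 _ _))//.
  by apply: ler_pM; rewrite ?invr_ge0 ?(ltW (h0 _ _))// lef_pV2 ?posrE.
rewrite [X in _ <= X](_ : _ = a^-1 * mdist x y `^ beta +
    Ch * mdist x y `^ beta * (a^-1 * a^-1)); last by rewrite expr2 invfM; ring.
by rewrite lerDr mulr_ge0 ?powR_ge0// invr_ge0 ltW.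
Qed.

(** The Doob transform of the transfer operator by the eigenfunctions; it fixes 1 and is dual to T
    for the measures h nu. *)
Let P n (g : Y n -> R) (x : Y n.+1) : R :=
  transfer T phi (fun y => g y * h y) x / (lam (iter n s o) * h x).

Let E n (g : Y n -> R) : R := \int[nu (iter n s o)]_x (g x * h x).

Lemma normalized_mixing : exists c d : R, [/\ 0 < c, 0 < d < 1 &
  forall m (G : forall n, Y n -> R) C,
    (forall n, (m <= n)%N -> G n.+1 = P (G n)) -> hoelder_le beta C (G m) ->
    forall n, (m <= n)%N -> hoelder_le beta (c * d ^+ (n - m) * C)
      (fun x => G n x - E (G m))].
Proof.
have [a a0 ha] := eigenfunction_inf; have [Ch hh] := eigenfunction_hoelder.
have [Ci Ci0 hi] := invh; have lam0 := eigenvalue_gt0.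
have h0 j (x : X j) : 0 < h x by apply: lt_le_trans (ha _ x).
have Ch0 : 0 < Ch.
  have [/(_ point) h1 _] := hh o; apply: lt_le_trans h1.
  by rewrite normr_gt0 gt_eqF.
case: rpf => _ [_ [_ [_ [_ [_ [C0 [d [C00 [d01 mixT]]]]]]]]].
(* Factors 2 come from the products with h and 1/h, and from passing to [hoelder_norm]. *)
exists (2 * (C0 * (2 * (2 * Ch))) * Ci), d; split=> //.
  by rewrite !mulr_gt0.
move=> m G C GS hG n mn; have Cp := hoelder_le_ge0 hG.
pose L n := \prod_(i < n - m) lam (iter i s (iter m s o)).
have LS k : (m <= k)%N -> L k.+1 = lam (iter k s o) * L k.
  by move=> mk; rewrite /L subSn// big_ord_recr /= -iterD subnK// mulrC.
pose G' k x := L k * (G k x * h x).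
have G'S k : (m <= k)%N -> G' k.+1 = transfer T phi (G' k).
  move=> mk; apply/funext=> x; rewrite /G' transferZ GS// LS// /P.
  have l0 := lam0 (iter k s o); have hx := h0 _ x.
  by field; rewrite !gt_eqF.
have [k e] : exists k, n = (k + m)%N by exists (n - m)%N; rewrite subnK.
subst n.
have hGm : hoelder_le beta (2 * C * Ch) (fun x => G m x * h x).
  exact: hoelder_leM (hh _).
have g_fin : (hoelder_norm beta (fun x => (G m x * h x)%R) < +oo)%E.
  by apply/hoelder_norm_ltyP; exists (2 * C * Ch).
have := mixT (iter m s o) k _ g_fin.
have G'm : G' m = (fun x => G m x * h x).
  by apply/funext=> x; rewrite /G' /L subnn big_ord0 mul1r.
pose c := (\prod_(i < k) lam (iter i s (iter m s o)))^-1.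
pose e := \int[nu (iter m s o)]_y (G m y * h y).
(* Stated on index-function pairs, the estimate can be moved from the index of [transfer_iter] to
   that of the family by rewriting. *)
pose Q (p : {i : I & X i -> R}) :=
  hoelder_norm beta (fun x => c * projT2 p x - e * h x).
rewrite -G'm => H.
have {H} : (Q (existT (fun i => X i -> R) (iter k s (iter m s o))
    (@transfer_iter R I s X T phi (iter m s o) k (G' m))) <=
    (C0 * d ^+ k)%:E * hoelder_norm beta (G' m))%E.
  by move: H; rewrite /Q /c /e /= G'm.
rewrite (transfer_iter_family k G'S) /Q /= => H.
have cL : c * L (k + m)%N = 1.
  rewrite /c /L addnK mulVf// prodf_seq_neq0; apply/allP => i _ /=.
  by rewrite gt_eqF.
have H1 : hoelder_le beta (C0 * (2 * (2 * Ch)) * d ^+ k * C)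
    (fun x => c * G' (k + m)%N x - e * h x).
  apply: le_hoelder_norm; apply: le_trans H _.
  rewrite G'm; apply: (@le_trans _ _
    ((C0 * d ^+ k)%:E * (2 * C * Ch + 2 * C * Ch)%:E)%E).
    apply: lee_wpmul2l; last exact: hoelder_norm_le.
    rewrite lee_fin mulr_ge0 ?exprn_ge0//; first exact: ltW.
    by case/andP: d01 => /ltW.
  rewrite -EFinM lee_fin le_eqVlt; apply/orP; left; apply/eqP; ring.
have := hoelder_leM H1 (hi _); rewrite addnK.
have -> : 2 * (C0 * (2 * (2 * Ch)) * d ^+ k * C) * Ci =
  2 * (C0 * (2 * (2 * Ch))) * Ci * d ^+ k * C by ring.
congr hoelder_le; apply/funext=> x; rewrite /G'.
have hx := h0 _ x.
have -> : c * (L (k + m)%N * (G (k + m)%N x * h x)) = G (k + m)%N x * h x.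
  by rewrite [LHS]mulrA cL mul1r.
by rewrite -mulrBl mulfK// gt_eqF.
Qed.

Lemma transfer_mixing_system : exists S : mixing_system beta T',
  forall n (g : Y n -> R), expect S g = E g.
Proof.
have [a a0 ha] := eigenfunction_inf; have [Ch hh] := eigenfunction_hoelder.
have [Ci Ci0 hi] := invh; have lam0 := eigenvalue_gt0.
have h0 j (x : X j) : 0 < h x by apply: lt_le_trans (ha _ x).
have Ch0 : 0 < Ch.
  have [/(_ point) h1 _] := hh o; apply: lt_le_trans h1.
  by rewrite normr_gt0 gt_eqF.
have hh' j : hoelder_fun beta (@h j) by exists Ch.
have [c [d [c0 d01 mixT]]] := normalized_mixing.
have [K0 lipK] := lipT; have [Cp hCp] := hphi.
have phiC j x : expR (- Cp) <= expR (@phi j x).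
  have [/(_ x) + _] := le_hoelder_norm (hCp j).
  by rewrite ler_expR ler_norml => /andP[].
case: rpf => _ [_ [nuh [[la [b [la0 lamb]]] [Lh [Lnu _]]]]].
have lam_b j : lam j <= b by have /andP[_] := lamb j; apply: le_trans; exact: ler_norm.
have b0 : 0 < b by apply: lt_le_trans (lam_b o).
(* A lower bound for the normalized weight e^phi(y) h(y) / (lam h(T y)). *)
have w0 : 0 < expR (- Cp) * a / (b * Ch).
  by rewrite divr_gt0// ?mulr_gt0// expR_gt0.
have PE n (g : Y n -> R) x :
    P g x = transfer T phi (fun y => g y * h y) x / (lam (iter n s o) * h x).
  by [].
have lh0 n (x : Y n.+1) : 0 < lam (iter n s o) * h x by rewrite mulr_gt0.
have hgh n (g : Y n -> R) : hoelder_fun beta g -> hoelder_fun beta (fun x => g x * h x).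
  by move=> hg; apply: hoelderM => //; exact: hh'.
unshelve eexists.
  apply: (@MixingSystem _ _ _ _ E P (Num.max K0 1 `^ beta)
    (expR (- Cp) * a / (b * Ch)) c d).
  - move=> n k f g hf hg; rewrite /E -(hoelder_RintegralZ beta_gt0); last exact: hgh.
    rewrite -(hoelder_RintegralD beta_gt0); [|by apply: hoelderZ; exact: hgh|exact: hgh].
    by congr Rintegral; apply/funext=> x; ring.
  - move=> n f hf f0; apply: Rintegral_ge0 => x _.
    by rewrite mulr_ge0// ltW.
  - move=> n; rewrite /E -[RHS](nuh (iter n s o)).
    by congr Rintegral; apply/funext=> x; rewrite mul1r.
  - by move=> n C u hu; exact: (hoelder_le_comp beta_gt0 (lipK _) hu).
  - move=> n k f g x; rewrite !PE mulrA -mulrDl -transferPZ.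
    by congr (transfer _ _ _ _ / _); apply/funext=> y; ring.
  - exact: w0.
  - move=> n f y f0; rewrite PE ler_pdivlMr//.
    apply: le_trans (transfer_ge _ _); last by move=> z; rewrite mulr_ge0// ltW.
    have lb : lam (iter n s o) * h (T y) <= b * Ch.
      apply: ler_pM; rewrite ?(ltW (lam0 _)) ?(ltW (h0 _ _))//.
      by have [/(_ (T y)) + _] := hh (s (iter n s o)); apply: le_trans; exact: ler_norm.
    apply: (@le_trans _ _ (expR (- Cp) * a / (b * Ch) * f y * (b * Ch))).
      by rewrite ler_wpM2l// mulr_ge0// ltW.
    have -> : expR (- Cp) * a / (b * Ch) * f y * (b * Ch) = expR (- Cp) * (f y * a).
      by field; rewrite !gt_eqF.
    apply: ler_pM; rewrite ?expR_ge0 ?mulr_ge0 ?(ltW a0)//.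
    by rewrite ler_wpM2l.
  - move=> n f x f0; rewrite PE divr_ge0 ?(ltW (lh0 _ _))//.
    by apply: transfer_ge0 => y; rewrite mulr_ge0// ltW.
  - move=> n u g x; rewrite !PE mulrA -transfer_pull.
    by congr (transfer _ _ _ _ / _); apply/funext=> y; ring.
  - move=> n x; rewrite PE (_ : (fun y => 1 * h y) = @h (iter n s o)); last first.
      by apply/funext=> y; rewrite mul1r.
    by rewrite Lh mulfV// gt_eqF.
  - move=> n g hg.
    have := hoelderZ (lam (iter n s o))^-1
      (hoelderM (hoelder_transfer (hgh _ _ hg)) (ex_intro _ Ci (hi _))).
    by congr hoelder_fun; apply/funext=> x; rewrite PE invfM; ring.
  - move=> n g hg; rewrite /E.
    have := Lnu (iter n s o) (fun x => g x * h x)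
      ((hoelder_norm_ltyP _ _).2 (hgh _ _ hg)).
    move=> /(congr1 (fun t => (lam (iter n s o))^-1 * t)).
    rewrite mulKf ?gt_eqF// => <-.
    rewrite -(hoelder_RintegralZ beta_gt0); last by apply: hoelder_transfer; exact: hgh.
    congr Rintegral; apply/funext=> x; rewrite PE.
    by field; rewrite !gt_eqF.
  - exact: c0.
  - exact: d01.
  - exact: mixT.
by [].
Qed.

End transfer_system.

(** * The initial measure *)

Section densities.
Context (R : realType) (M : pmetricType R) (m kappa : probability (borel M) R).

(** The density has integral 1, so it is positive at some p, and by continuity at least half that
    value on a ball around p. *)
Lemma density_bounds : hoelder_density m kappa ->
  exists c C rho p, [/\ 0 < c, 0 < C, 0 < rho &
    forall A : set (borel M), measurable A ->
      (kappa A <= C%:E * m A)%E /\ (c%:E * m (A `&` ball p rho) <= kappa A)%E].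
Proof.
move=> [al [psi [/andP[al0 _] psi_fin psi0 kE]]].
have [B hB] := (hoelder_norm_ltyP al psi).1 psi_fin.
have hpsi : hoelder_fun al psi by exists B.
have mpsi (A : set (borel M)) : measurable A ->
    measurable_fun A (fun x : borel M => (psi x)%:E).
  move=> mA; apply/measurable_EFinP; apply: measurable_funTS.
  exact: hoelder_measurable hpsi.
have B0 := hoelder_le_ge0 hB.
have [p p0] : exists p, 0 < psi p.
  apply: contrapT => /forallNP psi_le0.
  have psiE x : psi x = 0 by apply/eqP; rewrite eq_le psi0 andbT leNgt; apply/negP.
  have := kE setT measurableT; rewrite integral0_eq; last by move=> x _; rewrite psiE.
  by rewrite [LHS]probability_setT => -[] /eqP; rewrite oner_eq0.
have p20 : 0 < psi p / 2 by rewrite divr_gt0.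
have [rho rho0 prho] := hoelder_modulus al0 B0 p20.
exists (psi p / 2), (B + 1), rho, p; split=> //; first by rewrite ltr_wpDl.
move=> A mA; split.
  rewrite kE// -integral_cst//; apply: ge0_le_integral => //.
  - by move=> x _; rewrite lee_fin.
  - exact: mpsi.
  - move=> x _; rewrite lee_fin; have [/(_ x) + _] := hB.
    by move=> /(le_trans (ler_norm _)) /le_trans; apply; rewrite lerDl.
have mAB : measurable (A `&` (ball p rho : set (borel M))).
  by apply: measurableI => //; exact: measurable_ball_borel.
apply: (@le_trans _ _ (kappa (A `&` ball p rho))); last first.
  by apply: le_measure; rewrite ?inE//; exact: subIsetl.
rewrite kE// -integral_cst//; apply: ge0_le_integral => //.
- by move=> x _; rewrite lee_fin ltW.
- exact: mpsi.
- move=> x [_]; rewrite ballEmdist /= => px; rewrite lee_fin.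
  by have := prho _ _ _ _ hB px; rewrite ltr_norml; lra.
Qed.

Lemma Rintegral_le_scale (beta C : R) (g : M -> R) : 0 < beta -> 0 < C ->
  (forall A : set (borel M), measurable A -> (kappa A <= C%:E * m A)%E) ->
  hoelder_fun beta g -> (forall x, 0 <= g x) ->
  \int[kappa]_x g x <= C * \int[m]_x g x.
Proof.
move=> beta0 C0 kC hg g0.
have mg : measurable_fun setT (fun x : borel M => (g x)%:E).
  by apply/measurable_EFinP; exact: hoelder_measurable hg.
rewrite -lee_fin EFinM !(hoelder_EFin_Rintegral beta0)//.
have gE : (forall x : borel M, 0 <= (g x)%:E)%E by move=> x; rewrite lee_fin.
rewrite -(ge0_integral_mscale m measurableT (NngNum (ltW C0)) mg)//.
by apply: ge0_le_measure_integral => // A mA; exact: kC.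
Qed.

End densities.

(** A tent function. Lipschitz implies beta-Hoelder because the diameter is at most 1. It replaces
    the density of the initial measure, whose exponent need not be beta. *)
Lemma hoelder_bump (R : realType) (beta : R) (M : pmetricType R) (p : M) rho :
  0 < beta <= 1 -> 0 < rho -> (forall x y : M, mdist x y <= 1) ->
  exists g : M -> R, [/\ hoelder_fun beta g, forall x, 0 <= g x <= 1,
    forall x, rho <= mdist p x -> g x = 0 &
    forall x, mdist p x < rho / 2 -> 2^-1 <= g x].
Proof.
move=> /andP[b0 b1] rho0 d1.
pose g x := Num.max 0 (1 - mdist p x / rho).
have g01 x : 0 <= g x <= 1.
  rewrite /g le_max lexx /= ge_max ler01 /= gerDl oppr_le0.
  by rewrite divr_ge0 ?mdist_ge0// ltW.
exists g; split=> //.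
- exists (1 + rho^-1); split=> [x|x y].
    have /andP[g0 g1] := g01 x; rewrite ger0_norm//; apply: le_trans g1 _.
    by rewrite lerDl invr_ge0 ltW.
  have d0 := mdist_ge0 x y.
  have db : mdist x y <= mdist x y `^ beta.
    have [->|xy] := eqVneq (mdist x y) 0; first by rewrite powR0// gt_eqF.
    have xy0 : 0 < mdist x y by rewrite lt_neqAle eq_sym xy.
    rewrite -[leLHS]powRr1// ger_powR// xy0 d1//.
  apply: (@le_trans _ _ (rho^-1 * mdist x y)); last first.
    apply: (@le_trans _ _ (rho^-1 * mdist x y `^ beta)).
      by rewrite ler_wpM2l// invr_ge0 ltW.
    by rewrite ler_wpM2r ?powR_ge0// lerDr.
  have maxL (a b : R) : `|Num.max 0 a - Num.max 0 b| <= `|a - b|.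
    have := ler_norm (a - b); have := ler_norm (b - a); rewrite (distrC b a).
    by rewrite ler_norml; case: (leP 0 a); case: (leP 0 b); lra.
  apply: le_trans (maxL _ _) _.
  have -> : 1 - mdist p x / rho - (1 - mdist p y / rho) =
     rho^-1 * (mdist p y - mdist p x) by ring.
  rewrite normrM gtr0_norm ?invr_gt0// ler_pM2l ?invr_gt0//.
  have := metric_triangle p x y; have := metric_triangle p y x.
  rewrite (metric_sym y x) => h1 h2; rewrite ler_norml; apply/andP; split; lra.
- move=> x px; apply/max_idPl; rewrite subr_le0 ler_pdivlMr// mul1r//.
- move=> x px; rewrite /g le_max; apply/orP; right.
  have : mdist p x / rho < 2^-1 by rewrite ltr_pdivrMr// mulrC.
  lra.
Qed.

(** * Birkhoff sums under the initial measure *)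

Section birkhoff_integrals.
Context (R : realType) (I : Type) (s : I -> I) (X : I -> pmetricType R).
Context (T : forall j, X j -> X (s j)) (o : I) (beta : R).
Hypothesis beta_itv : 0 < beta <= 1.
Let Y n := X (iter n s o).
Let T' n : Y n -> Y n.+1 := @T (iter n s o).
Context (S : mixing_system beta T').
Local Notation E := (expect S).
Context (kappa0 nu0 : probability (borel (X o)) R).

Lemma map_iter_orbit_at n (x : X o) : map_iter T n x = orbit_at T' n x.
Proof. by elim: n => //= n ->. Qed.

Lemma birkhoff_sum_split (F : forall n, Y n -> R) k l x :
  birkhoff_sum T F (k + l) x =
  birkhoff_sum T F k x + bsum T' l F (orbit_at T' k x).
Proof.
rewrite /birkhoff_sum; under eq_bigr do rewrite map_iter_orbit_at.
by rewrite bsum_orbit; under eq_bigr do rewrite -map_iter_orbit_at.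
Qed.

Lemma birkhoff_sum_bsum (F : forall n, Y n -> R) n x :
  birkhoff_sum T F n x = bsum T' n F (x : Y 0).
Proof. by rewrite -[n]add0n birkhoff_sum_split /birkhoff_sum big_ord0 add0r. Qed.

Lemma hoelder_birkhoff (F : forall n, Y n -> R) n :
  (forall n, hoelder_fun beta (F n)) ->
  hoelder_fun beta (birkhoff_sum T F n : X o -> R).
Proof.
move=> hF; rewrite (_ : birkhoff_sum T F n = @bsum _ _ T' n 0 F).
  exact: (hoelder_bsum S n 0 hF).
by apply/funext=> x; exact: birkhoff_sum_bsum.
Qed.

Lemma birkhoff_sum_le (F : forall n, Y n -> R) n x C :
  (forall n x, `|F n x| <= C) -> `|birkhoff_sum T F n x| <= n%:R * C.
Proof. by move=> FC; rewrite birkhoff_sum_bsum; exact: bsum_le. Qed.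

Lemma measurable_norm_gt (g : X o -> R) C : hoelder_fun beta g ->
  measurable ([set x | C < `|g x|] : set (borel (X o))).
Proof.
move=> hg; have b0 : 0 < beta by case/andP: beta_itv.
have /(_ measurableT `]C, +oo[%classic (measurable_itv _)) :
    measurable_fun setT (Num.norm \o (g : borel (X o) -> R)).
  by apply: measurableT_comp => //; exact: (hoelder_measurable b0).
rewrite setTI; congr measurable; apply/seteqP; split=> x /=.
  by rewrite in_itv /= andbT.
by rewrite in_itv /= andbT.
Qed.

Lemma tight_birkhoff (H : forall n, Y n -> R) eps :
  (forall n, hoelder_fun beta (H n)) ->
  tight kappa0 (fun n => birkhoff_sum T H n.+1) -> 0 < eps ->
  exists2 C, 0 <= C & forall n,
    (kappa0 [set x | C < `|birkhoff_sum T H n x|]%R <= eps%:E)%E.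
Proof.
move=> hH tH eps0; have [C tC] := tH _ eps0.
have C0 : 0 <= Num.max C 0 by rewrite le_max lexx orbT.
exists (Num.max C 0) => // -[|n].
  rewrite (_ : [set x | _] = set0) ?measure0 ?lee_fin ?ltW//.
  by apply/seteqP; split=> // x; rewrite /= /birkhoff_sum big_ord0 normr0 ltNge C0.
apply: le_trans (tC n); apply: le_measure; rewrite ?inE.
- by apply: measurable_norm_gt; exact: hoelder_birkhoff.
- by apply: measurable_norm_gt; exact: hoelder_birkhoff.
- by move=> x /=; rewrite gt_max => /andP[].
Qed.

(** The cutoff of the sum from time k on, times the bump, is at most the indicator of a set inside
    the ball, where the initial measure dominates c nu0; [tight_from_orbit] then removes the
    bump. *)
Lemma tight_from_initial (Cn c rho : R) p : 0 < Cn -> 0 < c -> 0 < rho ->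
  (forall x y : X o, mdist x y <= 1) ->
  (forall rho : R, 0 < rho ->
     exists k, forall m (p : Y m) n (z : Y n), n = (k + m)%N ->
     exists w, [/\ is_orbit T' m w, mdist p (w m) < rho & w n = z]) ->
  (forall u : X o -> R, hoelder_fun beta u -> (forall x, 0 <= u x) ->
     E (u : Y 0 -> R) <= Cn * \int[nu0]_x u x) ->
  (forall A : set (borel (X o)), measurable A ->
     (c%:E * nu0 (A `&` ball p rho) <= kappa0 A)%E) ->
  exists k, forall (H : forall n, Y n -> R) B, (forall n, hoelder_le beta B (H n)) ->
    tight kappa0 (fun n => birkhoff_sum T H n.+1) -> tight_from S k H.
Proof.
move=> Cn0 c0 rho0 diam exactT ECn kc.
have beta0 : 0 < beta by case/andP: beta_itv.
have [g [hg g01 gout gin]] := hoelder_bump p beta_itv rho0 diam.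
have rho2 : 0 < rho / 2 by rewrite divr_gt0.
have half0 : (0 : R) < 2^-1 by [].
have [k tk] := tight_from_orbit S exactT rho2 half0 hg
  (fun x => proj1 (andP (g01 x))) gin.
exists k => H B hH tH; apply: tk => [n|eps eps0]; first by exists B.
have hH' n : hoelder_fun beta (H n) by exists B.
have B0 := hoelder_le_ge0 (hH 0).
have HB n x : `|H n x| <= B by have [] := hH n.
have [C C0 tC] := tight_birkhoff hH' tH (mulr_gt0 (divr_gt0 c0 Cn0) eps0).
(* The first k terms contribute at most k B; the 1 keeps the level positive. *)
pose C' := C + k%:R * B + 1.
have C'0 : 0 < C' by rewrite ltr_wpDl// addr_ge0// mulr_ge0.
exists C' => // l.
pose A := [set x : borel (X o) | C < `|birkhoff_sum T H (k + l) x|].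
have mA : measurable A by apply: measurable_norm_gt; exact: hoelder_birkhoff.
pose u (x : X o) := cutoff C' (bsum T' l H (orbit_at T' k (x : Y 0))) * g x.
have hu : hoelder_fun beta u.
  apply: hoelderM => //.
  apply: (hoelder_orbit S (u := fun z => cutoff C' (bsum T' l H z))).
  by apply: hoelder_cutoff => //; exact: (hoelder_bsum S).
have u0 x : 0 <= u x.
  by rewrite mulr_ge0 ?cutoff_ge0//; case/andP: (g01 x).
apply: le_trans (ECn _ hu u0) _.
have uA x : ((u x)%:E <= (\1_(A `&` ball p rho) x)%:E)%E.
  rewrite lee_fin /u indicE.
  have [xA|] := boolP (x \in A `&` ball p rho).
    rewrite -[leRHS]mulr1 ler_pM ?cutoff_ge0 ?cutoff_le1//;
    by case/andP: (g01 x).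
  move=> /negP; rewrite inE /= => xA.
  have [xp|xp] := leP rho (mdist p x); first by rewrite gout// mulr0.
  rewrite cutoff_eq0 ?mul0r//.
  have {xA} : `|birkhoff_sum T H (k + l) x| <= C.
    by rewrite leNgt; apply/negP => xC; apply: xA; split; rewrite // ballEmdist.
  rewrite birkhoff_sum_split => bC.
  have := birkhoff_sum_le k x HB.
  have := ler_normB (birkhoff_sum T H k x + bsum T' l H (orbit_at T' k (x : Y 0)))
    (birkhoff_sum T H k x).
  rewrite addrAC subrr add0r => h1 h2; apply: le_trans h1 _; rewrite /C'; lra.
have mAB : measurable (A `&` (ball p rho : set (borel (X o)))).
  by apply: measurableI => //; exact: measurable_ball_borel.
have nuA : ((\int[nu0]_x u x)%R%:E <= nu0 (A `&` ball p rho))%E.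
  rewrite (hoelder_EFin_Rintegral beta0)//.
  apply: (@le_trans _ _ (\int[nu0]_x (\1_(A `&` ball p rho) x)%:E)%E).
    apply: ge0_le_integral => //.
    - by move=> x _; rewrite lee_fin.
    - by apply/measurable_EFinP; exact: (hoelder_measurable beta0).
    - by apply/measurable_EFinP; exact: measurable_indic.
  by rewrite integral_indic// setIT.
have := le_trans (kc A mA) (tC (k + l)%N).
move=> /(le_trans (lee_wpmul2l (ltW c0 : (0 <= c%:E)%E) nuA)).
rewrite -EFinM lee_fin => H1.
rewrite -(ler_pM2l (divr_gt0 c0 Cn0)); apply: le_trans H1.
by rewrite mulrA divfK// gt_eqF.
Qed.

(** The mean minimizes the mean square deviation, so any centring b will do; the one from
    [span_bound] is not the mean. *)
Lemma std_dev_le (f : forall n, Y n -> R) n b V :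
  (forall n, hoelder_fun beta (f n)) ->
  \int[kappa0]_x ((birkhoff_sum T f n x - b) ^+ 2) <= V ->
  std_dev T kappa0 f n <= Num.sqrt V.
Proof.
move=> hf fV; have beta0 : 0 < beta by case/andP: beta_itv.
rewrite /std_dev ler_wsqrtr//; apply: le_trans fV.
have hg := hoelder_birkhoff n hf.
set g := birkhoff_sum T f n in hg *.
rewrite /variance covariance.unlock expectation.unlock.
pose m := \int[kappa0]_x g x.
have mE x : ((g \- cst m) * (g \- cst m)) x =
    (g x - b) ^+ 2 + (2 * (b - m) * (g x + - b) + (b - m) ^+ 2).
  by rewrite mulrfctE /=; ring.
rewrite [leLHS](_ : _ = \int[kappa0]_x ((g x - b) ^+ 2 +
    (2 * (b - m) * (g x + - b) + (b - m) ^+ 2))); last first.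
  by congr fine; apply: eq_integral => x _; rewrite -mE.
have hgb : hoelder_fun beta (fun x => g x + - b).
  by apply: hoelderD => //; exact: hoelder_const.
have hgb2 : hoelder_fun beta (fun x => (g x - b) ^+ 2) by exact: hoelderX.
rewrite (hoelder_RintegralD beta0)//; last first.
  by apply: hoelderD; [exact: hoelderZ | exact: hoelder_const].
rewrite (hoelder_RintegralD beta0)//; [|exact: hoelderZ|exact: hoelder_const].
rewrite (hoelder_RintegralZ beta0)// (hoelder_RintegralD beta0)//; last first.
  exact: hoelder_const.
rewrite !probability_Rintegral_cst -/m.
by have := sqr_ge0 (b - m); lra.
Qed.

End birkhoff_integrals.

(** * The group of frequencies *)

(** The generator is the infimum of the positive elements. If it were not attained, two elements
    above it would differ by less than eta; division with remainder does the rest. *)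
Lemma discrete_subgroup (R : realType) (G : set R) (eta : R) : 0 < eta ->
  G 0 -> (forall x y, G x -> G y -> G (x - y)) -> (exists2 x, G x & x != 0) ->
  (forall x, G x -> 0 < x -> eta <= x) ->
  exists2 h, 0 < h & G = [set h *~ k | k in [set: int]].
Proof.
move=> eta0 G0 GB [x0 Gx0 x0n0] Geta.
have GN x : G x -> G (- x) by move=> Gx; rewrite -sub0r; exact: GB.
have GD x y : G x -> G y -> G (x + y).
  by move=> Gx Gy; rewrite -[y]opprK; apply: GB => //; exact: GN.
pose A := [set x | G x /\ 0 < x].
have A0 : A !=set0.
  have [x00|x00|/eqP] := ltgtP x0 0; last by rewrite (negbTE x0n0).
    by exists (- x0); split; rewrite ?oppr_gt0//; exact: GN.
  by exists x0.
have Alb : lbound A eta by move=> x [Gx x_gt0]; exact: Geta.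
have Ainf : has_inf A by split=> //; exists eta.
pose h := inf A.
have eta_h : eta <= h by exact: lb_le_inf.
have h0 : 0 < h by apply: lt_le_trans eta_h.
have Gh : G h.
  have [x [Gx x0'] xh] := inf_adherent eta0 Ainf.
  have hx : h <= x by apply: ge_inf => //; case: Ainf.
  have [->//|hx'] := eqVneq h x.
  have {hx hx'} hx : h < x by rewrite lt_neqAle hx' hx.
  have xh0 : 0 < x - h by rewrite subr_gt0.
  have [y [Gy y0] yx] := inf_adherent xh0 Ainf.
  move: yx; rewrite -/h addrC subrK => yx.
  have hy : h <= y by apply: ge_inf => //; case: Ainf.
  have := Geta _ (GB _ _ Gx Gy); rewrite subr_gt0 => /(_ yx).
  by move: xh; rewrite -/h; lra.
exists h => //; apply/seteqP; split=> [x Gx|_ [k _ <-]].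
  pose k := Num.floor (x / h).
  have Ghk (j : int) : G (h *~ j).
    have Gn (n : nat) : G (h *+ n).
      by elim: n => [|n IH]; rewrite ?mulr0n// mulrS; exact: GD.
    by case: j => n; [exact: Gn | rewrite NegzE mulrNz; apply: GN; exact: Gn].
  exists k => //; apply/eqP; rewrite eq_sym -subr_eq0; apply/negPn/negP => xk.
  have kx : h *~ k <= x.
    by rewrite -mulrzr mulrC -ler_pdivlMr// ge_floor.
  have xk1 : x < h *~ k + h.
    have := floorD1_gt (x / h); rewrite -/k intrD mulr1z ltr_pdivrMr//.
    by rewrite mulrDl mul1r mulrzl.
  have Gxk : G (x - h *~ k) by exact: GB.
  have xk0 : 0 < x - h *~ k by rewrite lt_neqAle eq_sym xk subr_ge0.
  have : h <= x - h *~ k by apply: ge_inf; [case: Ainf | split].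
  lra.
have Gn (n : nat) : G (h *+ n).
  by elim: n => [|n IH]; rewrite ?mulr0n// mulrS; exact: GD.
by case: k => n; [exact: Gn | rewrite NegzE mulrNz; apply: GN; exact: Gn].
Qed.

Section spans.
Context (R : realType) (I : Type) (s : I -> I) (X : I -> pmetricType R).
Context (T : forall j, X j -> X (s j)) (o : I) (beta : R).
Hypothesis beta_itv : 0 < beta <= 1.
Let Y n := X (iter n s o).
Let T' n : Y n -> Y n.+1 := @T (iter n s o).
Context (S : mixing_system beta T').
Local Notation E := (expect S).
Context (kappa0 : probability (borel (X o)) R) (Ck : R) (k0 : nat).
Hypothesis Ck_gt0 : 0 < Ck.
Hypothesis kappa_le : forall g : X o -> R, hoelder_fun beta g ->
  (forall x, 0 <= g x) -> \int[kappa0]_x g x <= Ck * E (g : Y 0 -> R).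
Hypothesis tight_k0 : forall (H : forall n, Y n -> R) B,
  (forall n, hoelder_le beta B (H n)) ->
  tight kappa0 (fun n => birkhoff_sum T H n.+1) -> tight_from S k0 H.

Let beta0 : 0 < beta. Proof. by case/andP: beta_itv. Qed.

Lemma bounded_hoelderP (H : forall n, Y n -> R) :
  bounded_hoelder beta H <-> exists C, forall n, hoelder_le beta C (H n).
Proof.
split=> -[C hC]; first by exists C => n; exact: le_hoelder_norm.
by exists (C + C) => n; exact: hoelder_norm_le.
Qed.

(** The initial measure is at most Ck times the equivariant one, the first m terms are bounded by m
    B, and equivariance turns the rest into an expectation at time m. *)
Lemma square_integral_split (F : forall n, Y n -> R) B m l b V :
  (forall n, hoelder_le beta B (F n)) ->
  E (fun x : Y m => (bsum T' l F x - b) ^+ 2) <= V ->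
  \int[kappa0]_x ((birkhoff_sum T F (m + l) x - b) ^+ 2) <=
    Ck * (2 * (m%:R * B) ^+ 2 + 2 * V).
Proof.
move=> hF EV; have hF' n : hoelder_fun beta (F n) by exists B.
have B0 := hoelder_le_ge0 (hF 0).
have FB n x : `|F n x| <= B by have [] := hF n.
have hg : hoelder_fun beta (fun x : X o => (birkhoff_sum T F (m + l) x - b) ^+ 2).
  apply: hoelderX; apply: hoelderD; last exact: hoelder_const.
  exact: (hoelder_birkhoff S).
apply: le_trans (kappa_le hg (fun x => sqr_ge0 _)) _; rewrite ler_pM2l//.
have hu : hoelder_fun beta (fun z : Y m => (bsum T' l F z - b) ^+ 2).
  apply: hoelderX; apply: hoelderD; last exact: hoelder_const.
  exact: (hoelder_bsum S).
have hu' := hoelder_orbit S hu.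
apply: (@le_trans _ _ (E (fun x : Y 0 => 2 * (m%:R * B) ^+ 2 +
    2 * (bsum T' l F (orbit_at T' m x) - b) ^+ 2))).
  apply: expect_le => //.
    by apply: hoelderD; [exact: hoelder_const | exact: (hoelderZ 2 hu')].
  move=> x; rewrite birkhoff_sum_split.
  have := birkhoff_sum_le T m x FB.
  set y := birkhoff_sum T F m x; set z := bsum T' l F _ => yB.
  have y2 : y ^+ 2 <= (m%:R * B) ^+ 2.
    by rewrite -[leLHS]real_normK ?num_real// ler_sqr ?nnegrE// mulr_ge0.
  by have := sqr_ge0 (y - (z - b)); lra.
rewrite expectD ?expect_cst; [|exact: hoelder_const|exact: (hoelderZ 2 hu')].
rewrite (expectZ S 2 hu') (expect_orbit1 S hu) lerD2l.
by rewrite ler_pM2l.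
Qed.

Lemma tight_square_integral (H : forall n, Y n -> R) B :
  (forall n, hoelder_le beta B (H n)) ->
  tight kappa0 (fun n => birkhoff_sum T H n.+1) ->
  exists V, forall n, \int[kappa0]_x (birkhoff_sum T H n x ^+ 2) <= V.
Proof.
move=> hH tH; have [_ [_ [_ [V [_ _ _ _ HV]]]]] :=
  tight_decomposition hH (tight_k0 hH tH).
have B0 := hoelder_le_ge0 (hH 0).
have hH' n : hoelder_fun beta (H n) by exists B.
have HB n x : `|H n x| <= B by have [] := hH n.
have V0 : 0 <= V.
  apply: le_trans (HV 0%N); apply: (expect_ge0 S) => [|x]; last exact: sqr_ge0.
  by apply: hoelderX; exact: (hoelder_bsum S).
have KB0 : 0 <= (k0%:R * B) ^+ 2 by exact: sqr_ge0.
exists (Ck * (2 * (k0%:R * B) ^+ 2 + 2 * V) + (k0%:R * B) ^+ 2) => n.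
have C1 : 0 <= Ck * (2 * (k0%:R * B) ^+ 2 + 2 * V).
  by rewrite mulr_ge0 ?(ltW Ck_gt0)// addr_ge0 ?mulr_ge0.
have [kn|nk] := leqP k0 n.
  rewrite -(subnKC kn); have := @square_integral_split H B k0 (n - k0) 0 V hH.
  have -> : (fun x : Y k0 => (bsum T' (n - k0) H x - 0) ^+ 2) =
    (fun x : Y k0 => bsum T' (n - k0) H x ^+ 2) by apply/funext=> x; rewrite subr0.
  move=> /(_ (HV _)) h; apply: (@le_trans _ _ (Ck * (2 * (k0%:R * B) ^+ 2 + 2 * V))).
    apply: le_trans h; rewrite le_eqVlt; apply/orP; left; apply/eqP.
    by congr Rintegral; apply/funext=> x; rewrite subr0.
  by rewrite lerDl.
apply: (@le_trans _ _ ((k0%:R * B) ^+ 2)); last by rewrite lerDr.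
rewrite -(probability_Rintegral_cst kappa0 ((k0%:R * B) ^+ 2)).
apply: (hoelder_le_Rintegral beta0).
- by apply: hoelderX; exact: (hoelder_birkhoff S).
- exact: hoelder_const.
- move=> x; rewrite -[leLHS]real_normK ?num_real// ler_sqr ?nnegrE//; last exact: mulr_ge0.
  apply: le_trans (birkhoff_sum_le T n x HB) _.
  by rewrite ler_wpM2r// ler_nat ltnW.
Qed.

Lemma tight_bounded (W : nat -> X o -> R) C : (forall n x, `|W n x| <= C) ->
  tight kappa0 (fun n => W n.+1).
Proof.
move=> WC eps eps0; exists C => n.
rewrite (_ : [set x | _] = set0) ?measure0 ?lee_fin ?ltW//.
by apply/seteqP; split=> // x; rewrite /= ltNge WC.
Qed.

Lemma tight_lincomb (V W : nat -> X o -> R) a b :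
  (forall n, hoelder_fun beta (V n)) -> (forall n, hoelder_fun beta (W n)) ->
  tight kappa0 (fun n => V n.+1) -> tight kappa0 (fun n => W n.+1) ->
  tight kappa0 (fun n x => a * V n.+1 x + b * W n.+1 x).
Proof.
move=> hV hW tV tW eps eps0; have e2 : 0 < eps / 2 by rewrite divr_gt0.
have [C1 VC] := tV _ e2; have [C2 WC] := tW _ e2.
exists (`|a| * C1 + `|b| * C2) => n.
have mV := measurable_norm_gt beta_itv C1 (hV n.+1).
have mW := measurable_norm_gt beta_itv C2 (hW n.+1).
have -> : eps%:E = ((eps / 2)%:E + (eps / 2)%:E)%E by rewrite -EFinD -splitr.
apply: (@le_trans _ _ (kappa0 ([set x | C1 < `|V n.+1 x|] `|`
    [set x | C2 < `|W n.+1 x|]))).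
  apply: le_measure; rewrite ?inE.
  - apply: (measurable_norm_gt beta_itv).
    by apply: hoelderD; exact: hoelderZ.
  - exact: measurableU.
  - move=> x /= ; apply: contraPP => /not_orP[/negP + /negP].
    rewrite -!leNgt => h1 h2; apply/negP; rewrite -leNgt.
    apply: le_trans (ler_normD _ _) _; rewrite !normrM.
    by apply: lerD; exact: ler_wpM2l.
by apply: le_trans (measureU2 _ mV mW) _; apply: leeD; [exact: VC | exact: WC].
Qed.

Lemma birkhoff_sum_lincomb (F G : forall n, Y n -> R) a b n x :
  birkhoff_sum T (fun n x => a * F n x + b * G n x) n x =
  a * birkhoff_sum T F n x + b * birkhoff_sum T G n x.
Proof. by rewrite /birkhoff_sum !mulr_sumr -big_split. Qed.

Lemma bounded_hoelder_lincomb (F G : forall n, Y n -> R) a b :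
  bounded_hoelder beta F -> bounded_hoelder beta G ->
  bounded_hoelder beta (fun n x => a * F n x + b * G n x).
Proof.
move=> /bounded_hoelderP[C hF] /bounded_hoelderP[C' hG]; apply/bounded_hoelderP.
exists (`|a| * C + `|b| * C') => n.
by apply: hoelder_leD; exact: hoelder_leZ.
Qed.

Lemma tight_birkhoff_lincomb (F G : forall n, Y n -> R) a b :
  bounded_hoelder beta F -> bounded_hoelder beta G ->
  tight kappa0 (fun n => birkhoff_sum T F n.+1) ->
  tight kappa0 (fun n => birkhoff_sum T G n.+1) ->
  tight kappa0 (fun n => birkhoff_sum T (fun n x => a * F n x + b * G n x) n.+1).
Proof.
move=> /bounded_hoelderP[C hF] /bounded_hoelderP[C' hG] tF tG.
have -> : (fun n => birkhoff_sum T (fun n x => a * F n x + b * G n x) n.+1) =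
    (fun n x => a * birkhoff_sum T F n.+1 x + b * birkhoff_sum T G n.+1 x).
  by apply/funext=> n; apply/funext=> x; rewrite birkhoff_sum_lincomb.
apply: (@tight_lincomb (birkhoff_sum T F) (birkhoff_sum T G)) => // n.
  by apply: (hoelder_birkhoff S) => i; exists C; exact: hF.
by apply: (hoelder_birkhoff S) => i; exists C'; exact: hG.
Qed.

Context (f : forall n, Y n -> R).
Hypothesis hf : bounded_hoelder beta f.

Let c n := \int[kappa0]_y f (map_iter T n y).

Definition frequency (t : R) :=
  exists (H : forall n, Y n -> R) (Z : forall n, Y n -> int),
  [/\ bounded_hoelder beta H, tight kappa0 (fun n => birkhoff_sum T H n.+1) &
      forall n x, t * (f x - c n) = H n x + (Z n x)%:~R].

Lemma frequency_reducible t : t != 0 ->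
  frequency t <-> reducible_to T kappa0 beta f t^-1.
Proof.
move=> t0; split=> [[H [Z [hH tH HZ]]]|[_ [H [Z [hH tH HZ]]]]].
  split; first by rewrite invr_eq0.
  (* The zero term brings the scaling into the form of the lemmas on linear combinations. *)
  exists (fun n x => t^-1 * H n x + 0 * H n x), Z; split.
  - exact: bounded_hoelder_lincomb.
  - exact: tight_birkhoff_lincomb.
  - move=> n x; rewrite mul0r addr0 -addrA -mulrDr -HZ mulKf//.
    by rewrite addrC subrK.
exists (fun n x => t * H n x + 0 * H n x), Z; split.
- exact: bounded_hoelder_lincomb.
- exact: tight_birkhoff_lincomb.
- by move=> n x; rewrite HZ -/(c n); field.
Qed.

Lemma frequency0 : frequency 0.
Proof.
exists (fun _ _ => 0), (fun _ _ => 0); split.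
- by apply/bounded_hoelderP; exists `|0 : R| => n; exact: hoelder_cst.
- apply: (@tight_bounded (birkhoff_sum T (fun _ _ => 0)) 0) => n x.
  by rewrite /birkhoff_sum big1// normr0.
- by move=> n x; rewrite mul0r addr0.
Qed.

Lemma frequencyB t u : frequency t -> frequency u -> frequency (t - u).
Proof.
move=> [H [Z [hH tH HZ]]] [H' [Z' [hH' tH' HZ']]].
exists (fun n x => 1 * H n x + (-1) * H' n x), (fun n x => Z n x - Z' n x); split.
- exact: bounded_hoelder_lincomb.
- exact: tight_birkhoff_lincomb.
- by move=> n x; rewrite mulrBl HZ HZ' rmorphB /=; ring.
Qed.

Lemma frequencyE : [set r^-1 | r in [set a | reducible_to T kappa0 beta f a]] `|` [set 0]
  = frequency.
Proof.
apply/seteqP; split=> [t [[r rf <-]|->]|t tf].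
- by apply/frequency_reducible; [case: rf => r0 _; rewrite invr_eq0 | rewrite invrK].
- exact: frequency0.
- have [->|t0] := eqVneq t 0; [by right | left].
  by exists t^-1; rewrite ?invrK//; exact/frequency_reducible.
Qed.

Hypothesis span_f : exists2 r0 : R, 0 < r0 & forall r, r0 < r ->
  forall (H : forall n, Y n -> R) (Z : forall n, Y n -> int) (c : nat -> R) BH k,
  (forall n, hoelder_le beta BH (H n)) ->
  (forall n x, f x = c n + H n x + r * (Z n x)%:~R) ->
  tight_from S k H ->
  exists n3 V (b : nat -> R), forall l,
    E (fun x : Y n3 => (bsum T' l f x - b l) ^+ 2) <= V.
Hypothesis sigma_infty : std_dev T kappa0 f @ \oo --> +oo.

Lemma reducible_bounded : exists2 r0, 0 < r0 &
  forall r, reducible_to T kappa0 beta f r -> r <= r0.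
Proof.
have [r0 r0_gt0 span] := span_f; exists r0 => // r [_ [H [Z [hH tH HZ]]]].
rewrite leNgt; apply/negP => rr; have /bounded_hoelderP[BH hBH] := hH.
have [n3 [V [b bV]]] := span r rr H Z c BH k0 hBH HZ (tight_k0 hBH tH).
have /bounded_hoelderP[Bf hBf] := hf.
pose V' := Ck * (2 * (n3%:R * Bf) ^+ 2 + 2 * V).
have sV l : std_dev T kappa0 f (n3 + l) <= Num.sqrt V'.
  apply: (std_dev_le beta_itv S (b := b l)); first by move=> n; exists Bf; exact: hBf.
  exact: square_integral_split hBf (bV l).
move: sigma_infty => /cvgryPgt/(_ (Num.sqrt V')) [N _ /(_ (n3 + N)%N)] /=.
by rewrite leq_addl => /(_ isT); rewrite ltNge sV.
Qed.

(* The mean of r Z_n o T_0^n is minus that of H_n o T_0^n, so recentring Z_n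
   adds to S_n H only its mean, which is bounded by the second moment bound. *)
Lemma int_reducible_mul r H Z : 0 < r -> reduction T kappa0 beta f r H Z ->
  int_reducible T kappa0 beta Z ->
  exists2 r', r < r' & reducible_to T kappa0 beta f r'.
Proof.
move=> r0 [hH tH HZ] [a a1 [a0 [H' [Z' [hH' tH' HZ']]]]].
exists (r * a); first by rewrite ltr_pMr.
split; first by rewrite mulf_neq0 ?(gt_eqF r0).
have /bounded_hoelderP[Bf hBf] := hf; have /bounded_hoelderP[BH hBH] := hH.
pose z n := \int[kappa0]_y (Z n (map_iter T n y))%:~R.
pose e n := \int[kappa0]_y H n (map_iter T n y).
have hHT n : hoelder_fun beta (fun y : X o => H n (map_iter T n y)).
  have := hoelder_orbit S (u := H n) (ex_intro _ BH (hBH n)).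
  by congr hoelder_fun; apply/funext=> x; rewrite map_iter_orbit_at.
have hfT n : hoelder_fun beta (fun y : X o => f (map_iter T n y)).
  have := hoelder_orbit S (u := @f n) (ex_intro _ Bf (hBf n)).
  by congr hoelder_fun; apply/funext=> x; rewrite map_iter_orbit_at.
have rz n : r * z n = - e n.
  (* Integrability of Z is not given directly, so Z is first expressed by the Hoelder functions f
     and H. *)
  have -> : z n = \int[kappa0]_y (r^-1 * (f (map_iter T n y) +
      (-1) * (H n (map_iter T n y)) + (- c n))).
    congr Rintegral; apply/funext=> y; rewrite HZ -/(c n).
    by field; rewrite gt_eqF.
  have h1 := hoelderZ (-1) (hHT n); have h2 := hoelderD (hfT n) h1.
  have h3 := hoelder_const beta (X o) (- c n).
  rewrite (hoelder_RintegralZ beta0); last exact: hoelderD.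
  rewrite (hoelder_RintegralD beta0)// (hoelder_RintegralD beta0)//.
  rewrite (hoelder_RintegralZ beta0)// probability_Rintegral_cst -/(e n) -/(c n).
  by rewrite mulVKf ?gt_eqF//; ring.
have eB n : `|e n| <= BH.
  have HB x : - BH <= H n (map_iter T n x) <= BH.
    by rewrite -ler_norml; have [] := hBH n.
  rewrite ler_norml; apply/andP; split.
    rewrite -(probability_Rintegral_cst kappa0 (- BH)).
    apply: (hoelder_le_Rintegral beta0) => //; first exact: hoelder_const.
    by move=> x; case/andP: (HB x).
  rewrite -[X in _ <= X](probability_Rintegral_cst kappa0 BH).
  apply: (hoelder_le_Rintegral beta0) => //; first exact: hoelder_const.
  by move=> x; case/andP: (HB x).
have [V HV] := tight_square_integral hBH tH.
have hbH n : hoelder_fun beta (birkhoff_sum T H n : X o -> R).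
  by apply: (hoelder_birkhoff S) => i; exists BH; exact: hBH.
have eS n : \sum_(j < n) e j = \int[kappa0]_x birkhoff_sum T H n x.
  elim: n => [|n IH].
    rewrite big_ord0 -[LHS](probability_Rintegral_cst kappa0 0).
    by congr Rintegral; apply/funext=> x; rewrite /birkhoff_sum big_ord0.
  rewrite big_ord_recr /= IH -(hoelder_RintegralD beta0)//.
  by congr Rintegral; apply/funext=> x; rewrite /birkhoff_sum big_ord_recr.
have eSB n : `|\sum_(j < n) e j| <= 1 + V.
  have h2 := hoelderX 2 (hbH n).
  have h1 : hoelder_fun beta (fun x : X o => 1 + birkhoff_sum T H n x ^+ 2).
    by apply: hoelderD => //; exact: hoelder_const.
  have hN := hoelderZ (-1) h1.
  have V1 : \int[kappa0]_x (1 + birkhoff_sum T H n x ^+ 2) <= 1 + V.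
    rewrite (hoelder_RintegralD beta0)//; last exact: hoelder_const.
    by rewrite probability_Rintegral_cst lerD2l.
  (* It bounds the mean of S_n H by its second moment. *)
  have tb (t : R) : -1 * (1 + t ^+ 2) <= t <= 1 + t ^+ 2.
    have := sqr_ge0 (t + 1); have := sqr_ge0 (t - 1); have := sqr_ge0 t.
    by move=> ? ? ?; apply/andP; split; lra.
  rewrite eS ler_norml; apply/andP; split.
    have : \int[kappa0]_x (-1 * (1 + birkhoff_sum T H n x ^+ 2)) <=
        \int[kappa0]_x birkhoff_sum T H n x.
      apply: (hoelder_le_Rintegral beta0) => // x.
      by case/andP: (tb (birkhoff_sum T H n x)).
    by rewrite (hoelder_RintegralZ beta0)//; lra.
  apply: le_trans V1; apply: (hoelder_le_Rintegral beta0) => // x.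
  by case/andP: (tb (birkhoff_sum T H n x)).
have he : bounded_hoelder beta (fun n (_ : Y n) => e n).
  apply/bounded_hoelderP; exists BH => n.
  exact: hoelder_leW (eB n) (hoelder_cst _ _ _).
have te : tight kappa0 (fun n => birkhoff_sum T (fun n (_ : Y n) => e n) n.+1).
  apply: (@tight_bounded (birkhoff_sum T (fun n (_ : Y n) => e n)) (1 + V)) => n x.
  exact: eSB.
(* Substituting Z = z + H' + a Z' in f = c + H + r Z and using r z = - e. *)
exists (fun n x => 1 * (1 * H n x + r * H' n x) + (-1) * e n), Z'; split.
- apply: (@bounded_hoelder_lincomb (fun n x => 1 * H n x + r * H' n x)) => //.
  exact: bounded_hoelder_lincomb.
- apply: (@tight_birkhoff_lincomb (fun n x => 1 * H n x + r * H' n x)) => //.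
    exact: bounded_hoelder_lincomb.
  exact: tight_birkhoff_lincomb.
- move=> n x; rewrite HZ HZ' -/(z n) !mulrDr rz -/(c n); ring.
Qed.

Lemma reducible_frequencies : reducible T kappa0 beta f ->
  exists h0 : R,
    [/\ 0 < h0,
        [set r^-1 | r in [set a | reducible_to T kappa0 beta f a]] `|` [set 0] =
          [set h0 *~ k | k in [set: int]],
        reducible_to T kappa0 beta f h0^-1 /\
          (forall r, 0 < r -> reducible_to T kappa0 beta f r -> r <= h0^-1) &
        exists H Z, reduction T kappa0 beta f h0^-1 H Z /\
          ~ int_reducible T kappa0 beta Z].
Proof.
move=> [a redf]; have a0 : a != 0 by case: redf.
have [r0 r0_gt0 r0P] := reducible_bounded.
have [|||||h0 h0_gt0 freqE] := @discrete_subgroup R frequency r0^-1.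
- by rewrite invr_gt0.
- exact: frequency0.
- exact: frequencyB.
- exists a^-1; last by rewrite invr_eq0.
  by apply/frequency_reducible; rewrite ?invr_eq0// invrK.
- move=> x fx x0; rewrite -[leRHS]invrK lef_pV2 ?posrE ?invr_gt0//.
  by apply: r0P; apply/frequency_reducible => //; rewrite gt_eqF.
have fh0 : frequency h0 by rewrite freqE; exists 1.
have redh : reducible_to T kappa0 beta f h0^-1.
  by apply/frequency_reducible => //; rewrite gt_eqF.
have maxh r : 0 < r -> reducible_to T kappa0 beta f r -> r <= h0^-1.
  move=> r_gt0 redr; have : frequency r^-1.
    by apply/frequency_reducible; rewrite ?invr_eq0 ?gt_eqF// invrK.
  rewrite freqE => -[k _ kr].
  have k0' : 0 < k.
    have : 0 < r^-1 by rewrite invr_gt0.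
    by rewrite -kr pmulrz_rgt0.
  rewrite -[leLHS]invrK lef_pV2 ?posrE ?invr_gt0// -kr -[leLHS]mulr1z.
  by rewrite ler_pMz2l// -gtz0_ge1.
exists h0; split=> //; first by rewrite frequencyE.
have [_ [H [Z redHZ]]] := redh; exists H, Z; split=> // Zred.
have h0V : 0 < h0^-1 by rewrite invr_gt0.
have [r' rr' redr'] := int_reducible_mul h0V redHZ Zred.
by have := maxh r' (lt_trans h0V rr') redr'; rewrite leNgt rr'.
Qed.

End spans.

(** * Comparison of the reference measures, and conclusion *)

Lemma weighted_bounds (R : realType) (beta a C : R) (M : pmetricType R)
    (h : M -> R) (nu mu : probability (borel M) R) :
  0 < beta -> 0 <= a -> hoelder_fun beta h -> (forall x, a <= h x <= C) ->
  (forall A : set (borel M), measurable A -> mu A = (\int[nu]_(x in A) (h x)%:E)%E) ->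
  forall A : set (borel M), measurable A ->
    (a%:E * nu A <= mu A)%E /\ (mu A <= C%:E * nu A)%E.
Proof.
move=> beta0 a0 hh haC muE A mA; rewrite muE// -!integral_cst//.
have mh : measurable_fun A (fun x : borel M => (h x)%:E).
  by apply/measurable_EFinP; apply: measurable_funTS; exact: hoelder_measurable hh.
split; apply: ge0_le_integral => //.
- by move=> x _; rewrite lee_fin; case/andP: (haC x).
- by move=> x _; rewrite lee_fin; apply: le_trans a0 _; case/andP: (haC x).
- by move=> x _; rewrite lee_fin; case/andP: (haC x).
Qed.

(* When c = one_sided, the prescribed reference measures are the nu j. *)
Theorem theorem1p5 (R : realType) (c : horizon) (X : time c -> pmetricType R)
    (T : forall j, X j -> X (time_succ j)) (xi gamma beta : R)
    (phi : forall j, X j -> R)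
    (h : forall j, X j -> R)
    (nu mu : forall j, probability (borel (X j)) R)
    (lam : time c -> R)
    (kappa0 : probability (borel (X (time_zero c))) R)
    (f : forall n : nat, X (iter n (@time_succ c) (time_zero c)) -> R) :
  (forall j (x y : X j), mdist x y <= 1) ->
  0 < xi <= 1 -> 1 < gamma ->
  pairing T xi gamma -> bounded_degree T -> uniformly_lipschitz T ->
  covering T xi ->
  0 < beta <= 1 ->
  bounded_hoelder beta phi ->
  (c = one_sided -> reference_measures T phi nu /\ forall j, lam j = 1) ->
  rpf_triplets T phi beta h nu lam ->
  weighted_measures h nu mu ->
  hoelder_density
    (match c with
     | one_sided => nu (time_zero c)
     | two_sided => mu (time_zero c)
     end) kappa0 ->
  bounded_hoelder beta f ->
  reducible T kappa0 beta f ->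
  std_dev T kappa0 f @ \oo --> +oo ->
  let Rset := [set a | reducible_to T kappa0 beta f a] in
  exists h0 : R,
    [/\ 0 < h0,
        [set r^-1 | r in Rset] `|` [set 0] = [set h0 *~ k | k in [set: int]],
        Rset h0^-1 /\ (forall r, 0 < r -> Rset r -> r <= h0^-1) &
        exists H Z, reduction T kappa0 beta f h0^-1 H Z /\
          ~ int_reducible T kappa0 beta Z].
Proof.
move=> diam xi_itv gamma1 pairT _ lipT [n0 [covT _]] beta_itv hphi _ rpf muE.
move=> dens hf redf sigma Rset.
have beta0 : 0 < beta by case/andP: beta_itv.
have [a a0 ha] := eigenfunction_inf rpf.
have [Ch hh] := eigenfunction_hoelder rpf.
have hCh j (x : X j) : a <= h j x <= Ch.
  by rewrite ha; have [/(_ x) + _] := hh j; apply: le_trans; exact: ler_norm.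
have Ch0 : 0 < Ch.
  apply: lt_le_trans a0 _.
  by case/andP: (hCh _ (point : X (time_zero c))) => /le_trans; apply.
have [S SE] := transfer_mixing_system (time_zero c) xi_itv beta0 pairT lipT hphi rpf.
have [m [mE kd]] : exists m : probability (borel (X (time_zero c))) R,
    (m = nu (time_zero c) \/ m = mu (time_zero c)) /\ hoelder_density m kappa0.
  exists (match c with one_sided => nu (time_zero c) | two_sided => mu (time_zero c) end).
  by split; [destruct c; [left | right] | exact: dens].
(* In both cases the reference measure of the density is comparable to nu at time zero, so the cases
   need no further distinction. *)
have [a1 [a2 [a10 a20 mnu]]] : exists a1 a2 : R, [/\ 0 < a1, 0 < a2 &
    forall A : set (borel (X (time_zero c))), measurable A ->
      (a1%:E * nu (time_zero c) A <= m A)%E /\ (m A <= a2%:E * nu (time_zero c) A)%E].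
  case: mE => ->.
    by exists 1, 1; split=> // A _; rewrite mul1e.
  exists a, Ch; split=> //; apply: (weighted_bounds beta0 (ltW a0) _ (hCh (time_zero c))).
    by exists Ch; exact: hh.
  exact: muE.
have [d [C [rho [p [d0 C0 rho0 km]]]]] := density_bounds kd.
have k_le (A : set (borel (X (time_zero c)))) : measurable A ->
    (kappa0 A <= (C * a2)%:E * nu (time_zero c) A)%E.
  move=> mA; apply: le_trans (km A mA).1 _; rewrite EFinM -muleA.
  by apply: lee_wpmul2l; [rewrite lee_fin ltW | exact: (mnu A mA).2].
have k_ge (A : set (borel (X (time_zero c)))) : measurable A ->
    ((d * a1)%:E * nu (time_zero c) (A `&` ball p rho) <= kappa0 A)%E.
  move=> mA; apply: le_trans (km A mA).2; rewrite EFinM -muleA.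
  apply: lee_wpmul2l; first by rewrite lee_fin ltW.
  apply: (mnu _ _).1; apply: measurableI => //; exact: measurable_ball_borel.
have hho : hoelder_fun beta (h (time_zero c)) by exists Ch; exact: hh.
(* Expectations carry the weight h >= a, so passing from nu to [expect] costs a factor 1/a. *)
have Ck0 : 0 < C * a2 / a by rewrite divr_gt0// mulr_gt0.
have kappa_le (g : X (time_zero c) -> R) : hoelder_fun beta g -> (forall x, 0 <= g x) ->
    \int[kappa0]_x g x <= C * a2 / a * expect S (n := 0) g.
  move=> hg g0; apply: le_trans (Rintegral_le_scale beta0 _ k_le hg g0) _.
    exact: mulr_gt0.
  rewrite SE -mulrA ler_pM2l ?mulr_gt0// mulrC ler_pdivlMr// mulrC.
  rewrite -(hoelder_RintegralZ beta0)//.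
  apply: (hoelder_le_Rintegral beta0); [exact: hoelderZ | exact: hoelderM |].
  by move=> x; rewrite mulrC ler_wpM2l// ha.
pose Y n := X (iter n (@time_succ c) (time_zero c)).
pose T' n : Y n -> Y n.+1 := T (iter n (@time_succ c) (time_zero c)).
have surjT n (z : Y n.+1) : exists y, T' n y = z.
  exact: (map_surj xi_itv pairT).
have pairT' n (x x' : Y n.+1) (y : Y n) : mdist x x' <= xi -> T' n y = x ->
    exists2 y', T' n y' = x' & mdist y y' <= gamma^-1 * mdist x x'.
  exact: (map_pair pairT).
have coverT := cover_orbit (o := time_zero c) covT.
have exactT := exactness xi_itv gamma1 pairT' coverT.
have expect_le_nu (u : X (time_zero c) -> R) : hoelder_fun beta u ->
    (forall x, 0 <= u x) ->
    expect S (n := 0) u <= Ch * \int[nu (time_zero c)]_x u x.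
  move=> hu u0; rewrite SE -(hoelder_RintegralZ beta0)//.
  apply: (hoelder_le_Rintegral beta0); [exact: hoelderM | exact: hoelderZ |].
  by move=> x; rewrite mulrC ler_wpM2r//; case/andP: (hCh _ x).
have [k tk] := tight_from_initial beta_itv Ch0 (mulr_gt0 d0 a10) rho0
  (diam (time_zero c)) exactT expect_le_nu k_ge.
have [Bf hBf] : exists B, forall n, hoelder_le beta B (f n).
  by case: hf => B hB; exists B => n; exact: le_hoelder_norm.
have span := span_bound S beta0 xi_itv gamma1 surjT pairT' coverT hBf.
exact: (reducible_frequencies beta_itv Ck0 kappa_le tk hf span sigma redf).
Qed.
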